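(* Let $G=(V,E)$ be a finite connected digraph, $\ell\in\mathbb{R}^E$ with $\ell_{ij}>0$ for all $ij\in E$, and $b\in\mathbb{R}^V$ with $\sum_{i\in V} b_i=0$. Assume that the transshipment problem ''minimise $\ell^{T}f$ over $f\in\mathbb{R}^E$ subject to $Bf=b$, $f\ge 0$'' is feasible and that the optimal set $\hat H$ is connected. Let $\sigma(t)$, $t\ge 0$, be the conductivity vector of the Physarum Solver for $(G,b,\ell)$ started from an arbitrary initial state $\sigma(0)$ with $\sigma_{ij}(0)>0$ for all $ij\in E$, and let $p(t)\in\mathbb{R}^V$ be the corresponding potential (normalised by $\min_i p_i(t)=0$). Let $(H^*,p^* )$, $\hat H\subset H^*\subset G$, $p^*\in\mathbb{R}^{V(H^* )}$, be the $\infty$-harmonic extension of $(\hat H,\hat p)$. Then there exist constants $a>0$ and $T\ge 0$ such that $$\max_{i\in V(H^* )}|p_i(t)-p^*_i|\le e^{-a t}\qquad\text{for all } t\ge T .$$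
   Context: Digraphs have no loops and no multiple arcs (a pair of opposite arcs $ij,ji$ is allowed); a digraph is connected if its underlying undirected graph is connected. For an arc $ij$, $i$ is the tail and $j$ the head. The boundary operator is $B\in\mathbb{R}^{V\times E}$ with $B_{ie}=+1$ if $i$ is the tail of $e$, $B_{ie}=-1$ if $i$ is the head of $e$, and $B_{ie}=0$ otherwise. $\Phi^+=\{f\in\mathbb{R}^E: Bf=b,\ f\ge 0\}$ is the set of positive flows (the problem is feasible if $\Phi^+\ne\emptyset$), and $\hat\Phi\subset\Phi^+$ is the set of positive flows minimising $\ell(f)=\ell^{T}f=\sum_{ij\in E}\ell_{ij}f_{ij}$ over $\Phi^+$. The optimal set $\hat H$ is the subgraph of $G$ induced by the arc set $\bigcup_{f\in\hat\Phi}\operatorname{supp} f$ (its vertices are the endpoints of these arcs). Physarum Solver: given a conductivity vector $\sigma\in\mathbb{R}^E$ with all entries positive, let $L(\sigma)=B\,\mathrm{diag}(\sigma/\ell)\,B^{T}$ and let $p\in\mathbb{R}^V$ be the solution of $L(\sigma)p=b$ with $\min_i p_i=0$ (unique since $G$ is connected). The corresponding current is $\phi_{ij}=\sigma_{ij}(p_i-p_j)/\ell_{ij}$, $ij\in E$. The conductivity vector $\sigma(t)$ evolves for $t\ge0$ according to $\frac{d}{dt}\sigma_{ij}(t)+\sigma_{ij}(t)=\phi_{ij}(t)$, $ij\in E$, where $p(t)$ and $\phi(t)$ are the potential and the current obtained from $\sigma(t)$ in this way. The potential $\hat p$: every oriented cycle in $\hat H$ (a cycle of the underlying undirected graph, arcs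 traversed backwards counted with negative length) has total length zero, so when $\hat H$ is connected there is a unique $\hat p\in\mathbb{R}^{V(\hat H)}$ with $\hat p_i-\hat p_j=\ell_{ij}$ for every arc $ij$ of $\hat H$ and $\min\hat p=0$. The extension $(H^*,p^* )$: for a connected subgraph $H\subset G$ and $p\in\mathbb{R}^{V(H)}$, a (directed) trajectory to $H$ is a directed path $\pi$ in $G$, not contained in $H$, whose two endpoints lie in $V(H)$ and whose internal vertices all lie in $V(G)\setminus V(H)$ (in particular $\pi$ may be a single arc of $G$ that is not in $H$). If $\pi$ goes from $a$ to $b$, its $p$-slope is $r(p;\pi)=(p_a-p_b)/\ell(\pi)$, where $\ell(\pi)$ is the sum of the lengths of the arcs of $\pi$. Starting from $(H,p)=(\hat H,\hat p)$, repeat the following step: choose a trajectory $\pi$ to $H$ of maximum $p$-slope $r$ among all trajectories to $H$, provided that this maximum is positive (ties are broken by taking the first path in some fixed lexicographic order); replace $H$ by $H\cup\pi$ and extend $p$ to the internal vertices of $\pi$ so that $p_i-p_j=r\,\ell_{ij}$ for every arc $ij$ of $\pi$. If no trajectory of positive slope exists, stop and let $(H^*,p^* )$ be the current pair $(H,p)$. This pair is called the $\infty$-harmonic extension of $(\hat H,\hat p)$. *)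

(* Defs.v *)
From HB Require Import structures.
From mathcomp Require Import all_boot all_order all_algebra.
From mathcomp Require Import boolp classical_sets set_interval reals.
From mathcomp Require Import topology normedtype sequences exp.

Set Implicit Arguments.
Unset Strict Implicit.
Unset Printing Implicit Defensive.

Import Order.TTheory GRing.Theory Num.Theory.
Import numFieldNormedType.Exports.

Local Open Scope ring_scope.

(* A digraph on V is its arc set E : {set V * V}, the arc ij being the pair
   (i, j), with tail i and head j. A vector indexed by the arcs is a function
   V * V -> R, and a vector indexed by the vertices of a subgraph is a function
   V -> R; their values off the index set are never used. A subgraph induced by
   a set H of arcs is represented by H, its vertex set being [verts H]. *)

Definition adjacent (V : finType) (H : {set V * V}) : rel V :=
  fun i j => ((i, j) \in H) || ((j, i) \in H).

Definition connected_on (V : finType) (W : {set V}) (H : {set V * V}) : Prop :=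
  {in W &, forall i j, connect (adjacent H) i j}.

Definition connected_digraph (V : finType) (E : {set V * V}) : Prop :=
  [/\ (0 < #|V|)%N, forall i, (i, i) \notin E & connected_on [set: V] E].

Definition verts (V : finType) (H : {set V * V}) : {set V} :=
  [set i | [exists a in H, (i == a.1) || (i == a.2)]].

Definition boundary (R : realType) (V : finType) (i : V) (a : V * V) : R :=
  if i == a.1 then 1 else if i == a.2 then -1 else 0.

Definition positive_flow (R : realType) (V : finType) (E : {set V * V})
    (b : V -> R) (f : V * V -> R) : Prop :=
  (forall i, \sum_(a in E) boundary R i a * f a = b i) /\
  (forall a, a \in E -> 0 <= f a).

Definition flow_cost (R : realType) (V : finType) (E : {set V * V})
    (len f : V * V -> R) : R := \sum_(a in E) len a * f a.

Definition optimal_flow (R : realType) (V : finType) (E : {set V * V})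
    (len : V * V -> R) (b : V -> R) (f : V * V -> R) : Prop :=
  positive_flow E b f /\
  forall g, positive_flow E b g -> flow_cost E len f <= flow_cost E len g.

Definition optimal_set (R : realType) (V : finType) (E : {set V * V})
    (len : V * V -> R) (b : V -> R) : {set V * V} :=
  [set a in E | `[< exists2 f, optimal_flow E len b f & f a != 0 >]].

Definition min_zero_on (R : realType) (V : finType) (W : {set V})
    (p : V -> R) : Prop :=
  (forall i, i \in W -> 0 <= p i) /\ (exists2 i, i \in W & p i = 0).

Definition laplacian (R : realType) (V : finType) (E : {set V * V})
    (len sigma : V * V -> R) (i j : V) : R :=
  \sum_(a in E) boundary R i a * (sigma a / len a) * boundary R j a.

Definition potential (R : realType) (V : finType) (E : {set V * V})
    (len : V * V -> R) (b : V -> R) (sigma : V * V -> R) (p : V -> R) : Prop :=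
  (forall i, \sum_j laplacian E len sigma i j * p j = b i) /\
  min_zero_on [set: V] p.

Definition current (R : realType) (V : finType) (len sigma : V * V -> R)
    (p : V -> R) (a : V * V) : R :=
  sigma a * (p a.1 - p a.2) / len a.

(* The derivative at t of a function on D; it is one-sided at an end of D. *)
Definition has_derivative_in (R : realType) (D : set R) (f : R -> R)
    (t df : R) : Prop :=
  ((f s - f t) / (s - t) @[s --> within D t^'] --> df)%classic.

(* Only sigma 0 is required to be positive: the dynamics preserves positivity. *)
Definition physarum_solution (R : realType) (V : finType) (E : {set V * V})
    (len : V * V -> R) (b : V -> R)
    (sigma : R -> V * V -> R) (p : R -> V -> R) : Prop :=
  [/\ forall a, a \in E -> 0 < sigma 0 a,
      forall t, 0 <= t -> potential E len b (sigma t) (p t) &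
      forall t a, 0 <= t -> a \in E ->
        exists2 dsigma,
          has_derivative_in `[0, +oo[%classic (fun s => sigma s a) t dsigma &
          dsigma + sigma t a = current len (sigma t) (p t) a].

Definition optimal_potential (R : realType) (V : finType) (H : {set V * V})
    (len : V * V -> R) (p : V -> R) : Prop :=
  (forall a, a \in H -> p a.1 - p a.2 = len a) /\ min_zero_on (verts H) p.

Definition path_arcs (V : finType) (w : seq V) : seq (V * V) :=
  zip w (behead w).

Definition directed_path (V : finType) (E : {set V * V}) (w : seq V) : bool :=
  uniq w && all (mem E) (path_arcs w).

(* A path from x to y with internal vertices s is the sequence x :: rcons s y;
   it is contained in H iff all its arcs belong to H. *)
Definition trajectory (V : finType) (E H : {set V * V})
    (x : V) (s : seq V) (y : V) : bool :=
  let w := x :: rcons s y in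
  [&& directed_path E w, ~~ all (mem H) (path_arcs w),
      x \in verts H, y \in verts H & all (fun i => i \notin verts H) s].

Definition slope (R : realType) (V : finType) (len : V * V -> R)
    (p : V -> R) (x : V) (s : seq V) (y : V) : R :=
  (p x - p y) / \sum_(a <- path_arcs (x :: rcons s y)) len a.

Definition total_order (T : eqType) (r : rel T) : Prop :=
  [/\ reflexive r, antisymmetric r, transitive r & total r].

Fixpoint lexicographic (T : eqType) (r : rel T) (v w : seq T) : bool :=
  match v, w with
  | [::], _ => true
  | _ :: _, [::] => false
  | x :: v', y :: w' => if x == y then lexicographic r v' w' else r x y
  end.

Definition selected (R : realType) (V : finType) (E : {set V * V})
    (len : V * V -> R) (leV : rel V) (H : {set V * V}) (p : V -> R)
    (x : V) (s : seq V) (y : V) : Prop :=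
  [/\ trajectory E H x s y,
      0 < slope len p x s y &
      forall x' s' y', trajectory E H x' s' y' ->
        slope len p x' s' y' <= slope len p x s y /\
        (slope len p x' s' y' = slope len p x s y ->
         lexicographic leV (x :: rcons s y) (x' :: rcons s' y'))].

(* [harmonic_extension E len leV H p Hs ps]: the iteration started from (H, p)
   stops at (Hs, ps); ties are broken by the lexicographic order on vertex
   sequences induced by the total order leV on V. *)
Inductive harmonic_extension (R : realType) (V : finType) (E : {set V * V})
    (len : V * V -> R) (leV : rel V) :
    {set V * V} -> (V -> R) -> {set V * V} -> (V -> R) -> Prop :=
| Extension_stop H p :
    (forall x s y, trajectory E H x s y -> slope len p x s y <= 0) ->
    harmonic_extension E len leV H p H p
| Extension_step H p x s y p' Hs ps :
    selected E len leV H p x s y ->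
    (forall i, i \in verts H -> p' i = p i) ->
    (forall a, a \in path_arcs (x :: rcons s y) ->
       p' a.1 - p' a.2 = slope len p x s y * len a) ->
    harmonic_extension E len leV
      (H :|: [set a in path_arcs (x :: rcons s y)]) p' Hs ps ->
    harmonic_extension E len leV H p Hs ps.

(* Main.v *)
Require Import Defs.
From mathcomp Require Import all_boot all_order all_algebra ring lra.
From mathcomp Require Import boolp classical_sets set_interval reals.
From mathcomp Require Import topology normedtype sequences derive realfun exp.

Set Implicit Arguments.
Unset Strict Implicit.
Unset Printing Implicit Defensive.

Import Order.TTheory GRing.Theory Num.Theory.
Import numFieldNormedType.Exports.

Local Open Scope ring_scope.

(* Since (len ln sigma)' = drop p - len on each arc, len ln sigma + len t is, up
   to a constant, the drop along the arc of a vertex function P, the time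
   integral of p.

   On the optimal set. Let f be an optimal flow charging all of it, and y a dual
   solution. Then sum (- f len ln sigma + 2 len sigma) is nonincreasing up to an
   O(e^{-t}) term, so sigma is bounded above, and below on the optimal set. Hence
   P = phat t + O(1) there, and p is bounded.

   Extension. Let p0 be given on H with P = p0 t + O(1) on H, and let y extend p0
   to all vertices with slopes at most r outside H. There rho = e^{(1 - r) t} sigma
   satisfies len ln rho = drop (P - y t) - (r len - drop y) t + O(1), and rho is
   conserved up to O(e^{-r t}) at the vertices outside H. If rho were large on an
   arc, P - y t would drop much along it, so some level set of P - y t, lying on
   one side of H, would have a large outflow and a small inflow. So rho is bounded
   outside H, and exponentially small where y has slope less than r. On a
   trajectory of maximal slope r this bounds P - y t, hence also rho from below.

   Pointwise convergence. The energy of p - y with weights rho is exponentially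
   small by Kirchhoff's law, so p tends to y exponentially fast along the arcs on
   which rho is bounded below. *)

(** * Flows and potentials on a finite digraph *)

Definition loopless (V : finType) (F : {set V * V}) : Prop :=
  forall i, (i, i) \notin F.

Definition drop (R : realType) (V : finType) (u : V -> R) (a : V * V) : R :=
  u a.1 - u a.2.

(** The entry at [i] of [B g], with [B] restricted to the arcs of [F]; dually, [drop u] is
    [B^T u]. *)
Definition divergence (R : realType) (V : finType) (F : {set V * V})
    (g : V * V -> R) (i : V) : R :=
  \sum_(a in F) boundary R i a * g a.

Section Graph.
Variables (R : realType) (V : finType).
Implicit Types (F H E : {set V * V}) (u p q : V -> R) (g : V * V -> R).

Lemma dropB u p a : drop (fun i => u i - p i) a = drop u a - drop p a.
Proof. by rewrite /drop; ring. Qed.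

Lemma loopless_neq F a : loopless F -> a \in F -> a.1 != a.2.
Proof.
by case: a => i j hF aF /=; apply/eqP => ij; move: (hF i); rewrite {2}ij aF.
Qed.

Lemma boundary_drop i (a : V * V) : a.1 != a.2 ->
  boundary R i a = drop (fun j => (i == j)%:R) a.
Proof.
rewrite /boundary /drop => ha; case: (eqVneq i a.1) => [->|] /=.
  by rewrite (negPf ha) subr0.
by move=> _; case: (i == a.2); rewrite /= ?subr0 ?sub0r.
Qed.

Lemma sum_boundary u (a : V * V) : a.1 != a.2 ->
  \sum_i u i * boundary R i a = drop u a.
Proof.
move=> ha; rewrite (bigD1 a.1)//= (bigD1 a.2) ?(eq_sym a.2)//= big1.
  by rewrite /boundary eqxx eq_sym (negPf ha) eqxx /drop; ring.
by move=> i /andP[/negPf h1 /negPf h2]; rewrite /boundary h1 h2 mulr0.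
Qed.

(** Summation by parts: [drop] is adjoint to the divergence. The energy and duality identities below
    rest on it. *)
Lemma sum_divergence F u g : loopless F ->
  \sum_i u i * divergence F g i = \sum_(a in F) drop u a * g a.
Proof.
move=> hF; under eq_bigr do rewrite /divergence mulr_sumr.
rewrite exchange_big /=; apply: eq_bigr => a aF.
rewrite -(sum_boundary u (loopless_neq hF aF)) mulr_suml.
by apply: eq_bigr => i _; rewrite mulrA.
Qed.

Lemma divergence_setD E H g i : i \notin verts H ->
  divergence (E :\: H) g i = divergence E g i.
Proof.
move=> iH; rewrite /divergence [RHS](big_setID H) /= [X in X + _]big1 ?add0r//.
move=> a /setIP[_ aH]; rewrite /boundary.
have [i1 i2] : i != a.1 /\ i != a.2.
  by split; apply: contra iH => /eqP->; rewrite inE; apply/existsP; exists a;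
    rewrite aH eqxx ?orbT.
by rewrite (negPf i1) (negPf i2) mul0r.
Qed.

(** In [L(sigma) = B diag(sigma / len) B^T] the factor [B^T p] is the drop of [p], so the system for
    the potential becomes Kirchhoff's law for the current. *)
Lemma sum_laplacian E (len sigma : V * V -> R) p i : loopless E ->
  \sum_j laplacian E len sigma i j * p j = divergence E (current len sigma p) i.
Proof.
move=> hE; rewrite /laplacian; under eq_bigr do rewrite mulr_suml.
rewrite exchange_big /=; apply: eq_bigr => a aE.
have := sum_boundary p (loopless_neq hE aE); rewrite /drop => hd.
rewrite /current -hd mulr_sumr !mulr_suml mulr_sumr.
by apply: eq_bigr => j _; ring.
Qed.

Lemma verts_l H a : a \in H -> a.1 \in verts H.
Proof. by move=> aH; rewrite inE; apply/existsP; exists a; rewrite aH eqxx. Qed.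

Lemma verts_r H a : a \in H -> a.2 \in verts H.
Proof.
by move=> aH; rewrite inE; apply/existsP; exists a; rewrite aH eqxx orbT.
Qed.

Lemma vertsP H i :
  reflect (exists2 a, a \in H & i = a.1 \/ i = a.2) (i \in verts H).
Proof.
rewrite inE; apply: (iffP existsP) => -[a].
  by case/andP=> aH /orP[] /eqP h; exists a => //; [left|right].
by move=> aH h; exists a; rewrite aH; case: h => ->; rewrite eqxx ?orbT.
Qed.

(** [chi] counts, with signs, the traversals of each arc on an undirected walk from [i] to [j]. It
    does not depend on [q], so one chain transfers bounds from arcs to vertices at all times. *)
Lemma connect_chain H i j : connect (Defs.adjacent H) i j ->
  exists chi : V * V -> R, forall q, q i - q j = \sum_(a in H) chi a * drop q a.
Proof.
move=> /connectP[w hw ->] {j}; elim: w i hw => [|k w IH] i /=.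
  by move=> _; exists (fun=> 0) => q; rewrite subrr big1// => a _; rewrite mul0r.
case/andP=> ik /IH[chi hchi].
have [d hd] : exists d : V * V -> R,
    forall q, q i - q k = \sum_(a in H) d a * drop q a.
  have [ikH|kiH] := orP ik.
    exists (fun a => (a == (i, k))%:R) => q; rewrite (bigD1 (i, k))//= eqxx mul1r.
    by rewrite big1 ?addr0// => a /andP[_ /negPf->]; rewrite mul0r.
  exists (fun a => - (a == (k, i))%:R) => q; rewrite (bigD1 (k, i))//= eqxx.
  rewrite big1 ?addr0; first by rewrite /drop /=; ring.
  by move=> a /andP[_ /negPf->]; rewrite oppr0 mul0r.
exists (fun a => d a + chi a) => q.
under eq_bigr do rewrite mulrDl.
by rewrite big_split /= -hd -hchi; ring.
Qed.

Lemma connected_chains (W : {set V}) H root : connected_on W H -> root \in W ->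
  exists chi : V -> V * V -> R, forall i, i \in W -> forall q,
    q i - q root = \sum_(a in H) chi i a * drop q a.
Proof.
move=> hW rW.
pose P i (c : V * V -> R) := i \in W ->
  forall q, q i - q root = \sum_(a in H) c a * drop q a.
suff /choice[chi hchi] : forall i, exists c, P i c by exists chi.
move=> i; rewrite /P; case: (boolP (i \in W)) => [iW|_]; last by exists (fun=> 0).
by have [c hc] := connect_chain (hW i root iW rW); exists c => _.
Qed.

Lemma path_arcs_cons (x y : V) w :
  path_arcs (x :: y :: w) = (x, y) :: path_arcs (y :: w).
Proof. by []. Qed.

Lemma path_arcs_sum_drop q x w :
  \sum_(a <- path_arcs (x :: w)) drop q a = q x - q (last x w).
Proof.
elim: w x => [|y w IH] x; first by rewrite big_nil subrr.
by rewrite path_arcs_cons big_cons IH /drop /=; ring.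
Qed.

Lemma path_arcs_all (P : pred (V * V)) x w :
  all P (path_arcs (x :: w)) = path (fun i j => P (i, j)) x w.
Proof. by elim: w x => //= y w IH x; rewrite IH. Qed.

Lemma seq_multiplicity E (s : seq (V * V)) : all (mem E) s ->
  exists2 chi : V * V -> R, (forall a, 0 <= chi a) &
    forall F : V * V -> R, \sum_(a in E) chi a * F a = \sum_(a <- s) F a.
Proof.
elim: s => [_|a s IH /= /andP[aE /IH[chi h0 hchi]]].
  by exists (fun=> 0) => // F; rewrite big_nil big1// => a _; rewrite mul0r.
exists (fun c => (c == a)%:R + chi c) => [c|F]; first by rewrite addr_ge0.
under eq_bigr do rewrite mulrDl.
rewrite big_split /= hchi big_cons (bigD1 a)//= eqxx mul1r big1 ?addr0//.
by move=> c /andP[_ /negPf->]; rewrite mul0r.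
Qed.

Lemma chain_edge_zero (W : {set V}) H u :
  connected_on W H -> (forall a, a \in H -> drop u a = 0) ->
  {in W &, forall i j, u i = u j}.
Proof.
move=> hW h0 i j iW jW; have [chi hchi] := connect_chain (hW i j iW jW).
apply/eqP; rewrite -subr_eq0 hchi big1// => a aH; by rewrite h0 ?mulr0.
Qed.

(* Testing the Kirchhoff equations with the truncation (p - m)^+ shows that its
   Dirichlet energy vanishes. *)
Lemma max_principle E (W : {set V}) root (c : V * V -> R) p m :
  connected_digraph E -> (forall a, a \in E -> 0 < c a) -> root \in W ->
  (forall i, i \notin W -> divergence E (fun a => c a * drop p a) i = 0) ->
  (forall i, i \in W -> p i <= m) -> forall i, p i <= m.
Proof.
move=> [_ hl hc] c0 rW hdiv hm i.
pose psi i := Num.max (p i - m) 0.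
have psiW j : j \in W -> psi j = 0.
  by move=> /hm jm; rewrite /psi; apply/max_idPr; rewrite subr_le0.
have : \sum_(a in E) drop psi a * (c a * drop p a) = 0.
  rewrite -sum_divergence//; apply: big1 => j _.
  by case: (boolP (j \in W)) => [/psiW->|/hdiv->]; rewrite ?mul0r ?mulr0.
(* Truncation is nondecreasing and 1-Lipschitz, so [drop psi a] lies between [0] and [drop p a]. *)
have key a : a \in E -> c a * (drop psi a)^+2 <= drop psi a * (c a * drop p a).
  move=> /c0 ca; rewrite [leRHS]mulrCA ler_pM2l// /drop /psi.
  by rewrite /Num.max; case: ltP => h1; case: ltP => h2; nra.
have k0 a : a \in E -> 0 <= c a * (drop psi a)^+2.
  by move=> /c0/ltW ca; rewrite mulr_ge0 ?sqr_ge0.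
move/eqP; rewrite psumr_eq0; last by move=> a aE; exact: le_trans (k0 a aE) (key a aE).
move=> /allP hz.
have d0 a : a \in E -> drop psi a = 0.
  move=> aE; have := hz a (mem_index_enum a); rewrite aE => /eqP h.
  have := key a aE; rewrite h => h1; have := c0 a aE => ca.
  have : (drop psi a)^+2 <= 0 by rewrite -(pmulr_rle0 _ ca).
  by move=> h2; apply/eqP; rewrite -sqrf_eq0 eq_le sqr_ge0 h2.
have := chain_edge_zero hc d0 (finset.in_setT i) (finset.in_setT root).
rewrite (psiW root rW) /psi => h; rewrite -subr_le0 -h le_max lexx //.
Qed.

End Graph.

(** * Optimal flows and complementary slackness *)

Section Optimality.
Variables (R : realType) (V : finType) (E : {set V * V}).
Variables (len : V * V -> R) (b : V -> R).
Hypothesis hE : loopless E.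
Local Notation Hhat := (optimal_set E len b).

Lemma optimal_set_sub : Hhat \subset E.
Proof. by apply/fintype.subsetP => a; rewrite inE => /andP[]. Qed.

Lemma flow_cost_div (f : V * V -> R) (u : V -> R) :
  (forall i, divergence E f i = b i) ->
  \sum_(a in E) f a * drop u a = \sum_i u i * b i.
Proof.
move=> hf; under [RHS]eq_bigr do rewrite -hf.
by rewrite sum_divergence//; apply: eq_bigr => a _; rewrite mulrC.
Qed.

(* Strict complementarity: the average of optimal flows through each arc of
   the optimal set charges all of them. *)
Lemma full_optimal_flow : Hhat != finset.set0 ->
  exists2 f, optimal_flow E len b f &
    forall a, a \in E -> if a \in Hhat then 0 < f a else f a == 0.
Proof.
move=> H0.
pose P a (f : V * V -> R) := a \in Hhat -> optimal_flow E len b f /\ f a != 0.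
have /choice[g hg] : forall a, exists f, P a f.
  move=> a; rewrite /P; case: (boolP (a \in Hhat)) => [|_]; last by exists (fun=> 0).
  by rewrite inE => /andP[_ /asboolP[f hf fa]]; exists f.
pose n : R := #|Hhat|%:R.
have n0 : 0 < n by rewrite ltr0n card_gt0.
have nE : \sum_(c in Hhat) (1 : R) = n by rewrite sumr_const.
pose f e := n^-1 * \sum_(c in Hhat) g c e.
have fflow : positive_flow E b f.
  split=> [i|a aE].
    under eq_bigr do rewrite /f mulrCA mulr_sumr.
    rewrite -mulr_sumr exchange_big /=.
    rewrite (eq_bigr (fun=> b i)); last first.
      by move=> c /hg[[[hc _] _] _]; exact: hc.
    rewrite -[in LHS](mul1r (b i)) -mulr_suml nE mulrA mulVf ?mul1r//.
    by rewrite gt_eqF.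
  rewrite mulr_ge0 ?invr_ge0 ?(ltW n0)// sumr_ge0// => c /hg[[[_ hc] _] _].
  exact: hc.
have fopt : optimal_flow E len b f.
  split=> // h hh; rewrite /flow_cost.
  under eq_bigr do rewrite /f mulrCA mulr_sumr.
  rewrite -mulr_sumr exchange_big /= mulrC ler_pdivrMr// -nE mulr_sumr.
  apply: ler_sum => c /hg[[_ hc] _]; rewrite mulr1; exact: hc.
exists f => // a aE; case: ifPn => [aH|].
  rewrite mulr_gt0 ?invr_gt0// (bigD1 a)//= ltr_pwDl//; last first.
    by rewrite sumr_ge0// => c /andP[/hg[[[_ hc] _] _] _]; exact: hc.
  by have [[[_ hc] _] ga] := hg a aH; rewrite lt_neqAle eq_sym ga hc.
rewrite inE aE /= => /asboolP h; case: eqVneq => // fa.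
by case: h; exists f.
Qed.

Variable f : V * V -> R.
Hypothesis f_opt : optimal_flow E len b f.
Hypothesis f_supp : forall a, a \in E -> if a \in Hhat then 0 < f a else f a == 0.

(** No arc at [i] lies in the optimal set, so [f] vanishes on all of them. *)
Lemma optimal_balanced i : i \notin verts Hhat -> b i = 0.
Proof.
move=> iH; have [[hb _] _] := f_opt; rewrite -hb big1// => a aE.
have := f_supp aE; case: ifP => [aH _|_ /eqP->]; last by rewrite mulr0.
rewrite /boundary; case: eqVneq => [ia|_].
  by move: iH; rewrite ia verts_l.
by case: eqVneq => [ia|_]; rewrite ?mul0r//; move: iH; rewrite ia verts_r.
Qed.

Lemma optimal_sum_arcs (F : V * V -> R) :
  \sum_(a in E) f a * F a = \sum_(a in Hhat) f a * F a.
Proof.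
rewrite (big_setID Hhat) /= (finset.setIidPr optimal_set_sub) [X in _ + X]big1 ?addr0//.
move=> a /setDP[aE aH]; have := f_supp aE.
by rewrite (negPf aH) => /eqP->; rewrite mul0r.
Qed.

Hypothesis conn : connected_on (verts Hhat) Hhat.
Variable phat : V -> R.
Hypothesis phat_opt : optimal_potential Hhat len phat.

(* Otherwise pushing flow around the cycle formed by this path and a return
   chain in the optimal set would decrease the cost. *)
Lemma optimal_path_le x w : all (mem E) (path_arcs (x :: w)) ->
  x \in verts Hhat -> last x w \in verts Hhat ->
  phat x - phat (last x w) <= \sum_(a <- path_arcs (x :: w)) len a.
Proof.
move=> wE xH yH; set y := last x w in yH *; set L := \sum_(a <- _) _.
have [chi1 chi1_ge0 hchi1] := seq_multiplicity R wE.
have [chi2 hchi2] := connect_chain R (conn yH xH).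
have chi2E F : \sum_(a in E) (if a \in Hhat then chi2 a else 0) * F a =
    \sum_(a in Hhat) chi2 a * F a.
  rewrite (big_setID Hhat) /= (finset.setIidPr optimal_set_sub) [X in _ + X]big1 ?addr0.
    by apply: eq_bigr => a ->.
  by move=> a /setDP[_ /negPf->]; rewrite mul0r.
set chi2' := fun a => if a \in Hhat then chi2 a else 0 in chi2E.
have fpos a : a \in Hhat -> 0 < f a.
  by move=> aH; have := f_supp (fintype.subsetP optimal_set_sub _ aH); rewrite aH.
(* [S] bounds every ratio [|chi2 a| / f a], so pushing [1 / S] units along the return chain keeps
   the flow nonnegative on the optimal set. *)
pose S := 1 + \sum_(a in Hhat) `|chi2 a| / f a.
have Spos a : a \in Hhat -> 0 <= `|chi2 a| / f a.
  by move=> /fpos/ltW fa; rewrite mulr_ge0 ?invr_ge0.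
have S0 : 0 < S by rewrite ltr_pwDl// sumr_ge0.
pose g a := f a + S^-1 * (chi1 a + chi2' a).
have sumg F : \sum_(a in E) g a * F a = \sum_(a in E) f a * F a +
    S^-1 * (\sum_(a <- path_arcs (x :: w)) F a + \sum_(a in Hhat) chi2 a * F a).
  rewrite -hchi1 -chi2E -big_split /= mulr_sumr -big_split /=.
  by apply: eq_bigr => a _; rewrite /g -mulrDl mulrA -mulrDl.
have gflow : positive_flow E b g.
  split=> [i|a aE].
    have [[hb _] _] := f_opt; rewrite -hb.
    pose u j : R := (i == j)%:R.
    have hu h : \sum_(a in E) boundary R i a * h a = \sum_(a in E) h a * drop u a.
      apply: eq_bigr => a aE; rewrite mulrC; congr (_ * _).
      exact: boundary_drop (loopless_neq hE aE).
    (* The path contributes [u x - u y] and the chain [u y - u x]: the cycle has no divergence. *)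
    by rewrite !hu sumg path_arcs_sum_drop -hchi2 /y; ring.
  have [[_ f0] _] := f_opt; rewrite /g /chi2'; case: ifP => aH; last first.
    by rewrite addr0 addr_ge0 ?f0// mulr_ge0// invr_ge0 ltW.
  have : `|chi2 a| / f a <= S.
    rewrite /S (bigD1 a)//= addrCA lerDl addr_ge0// sumr_ge0// => c /andP[cH _].
    exact: Spos.
  rewrite ler_pdivrMr ?fpos// mulrC -ler_pdivrMr// => h.
  have h1 : - (f a) <= S^-1 * chi2 a.
    rewrite lerNl (le_trans _ h)// -mulrN mulrC ler_wpM2r ?invr_ge0 ?(ltW S0)//.
    by rewrite -normrN ler_norm.
  have h2 : 0 <= S^-1 * chi1 a by rewrite mulr_ge0// invr_ge0 ltW.
  by rewrite mulrDr; lra.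
have [_ /(_ g gflow)] := f_opt; rewrite /flow_cost.
have mc h : \sum_(a in E) len a * h a = \sum_(a in E) h a * len a.
  by apply: eq_bigr => a _; rewrite mulrC.
rewrite !mc sumg lerDl pmulr_rge0 ?invr_gt0//.
(* On the optimal set [len] is the drop of [phat], so the return chain costs [phat y - phat x]. *)
rewrite (_ : \sum_(a in Hhat) _ = phat y - phat x) -/L; first by lra.
rewrite hchi2; apply: eq_bigr => a aH; congr (_ * _).
by case: phat_opt => /(_ a aH) <-.
Qed.

End Optimality.

(** * Extending boundary values under a slope bound *)

Section Extension.
Variables (R : realType) (V : finType) (E H : {set V * V}).
Variables (len : V * V -> R) (p : V -> R) (r : R).
Hypothesis hlen : forall a, a \in E -> 0 < len a.
Hypothesis r0 : 0 <= r.
Hypothesis hslope : forall x s y, trajectory E H x s y ->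
  p x - p y <= r * \sum_(a <- path_arcs (x :: rcons s y)) len a.

Let arc : rel V := fun i j => (i, j) \in E :\: H.

Lemma mem_path_arcs (x : V) w a : a \in path_arcs (x :: w) ->
  (a.1 \in belast x w) && (a.2 \in w).
Proof.
elim: w x => //= y w IH x; rewrite inE => /orP[/eqP->|/IH/andP[h1 h2]] /=.
  by rewrite !inE !eqxx.
by rewrite inE h1 orbT inE h2 orbT.
Qed.

Lemma path_arcs_uniq (x : V) w : uniq (x :: w) -> uniq (path_arcs (x :: w)).
Proof.
elim: w x => //= y w IH x /andP[xw /IH yw]; rewrite yw andbT.
by apply: contra xw => /mem_path_arcs/andP[/mem_belast].
Qed.

Lemma sum_uniq_sub (s t : seq (V * V)) (F : V * V -> R) : uniq s ->
  {subset s <= t} -> (forall a, a \in t -> 0 <= F a) ->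
  \sum_(a <- s) F a <= \sum_(a <- t) F a.
Proof.
elim: s t => [|a s IH] t /=.
  by move=> _ _ h; rewrite big_nil big_seq sumr_ge0.
case/andP=> as_ us st ht; have at_ : a \in t by apply: st; rewrite mem_head.
rewrite big_cons (big_rem a at_) /= lerD2l; apply: IH => // [c cs|c /mem_rem/ht//].
apply: rem_mem; first by apply: contraNneq as_ => <-.
by apply: st; rewrite inE cs orbT.
Qed.

(** Removing the loops of the walk leaves a simple path that meets [H] only at its ends, hence a
    trajectory, and that is no longer than the walk. *)
Lemma walk_slope x w : path arc x w -> x \in verts H -> last x w \in verts H ->
  (forall i, i \in w -> i \in verts H -> i = last x w) ->
  p x - p (last x w) <= r * \sum_(a <- path_arcs (x :: w)) len a.
Proof.
move=> hw xH; have hwE : all (mem (E :\: H)) (path_arcs (x :: w)).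
  by rewrite path_arcs_all.
have wE a : a \in path_arcs (x :: w) -> (a \in E) && (a \notin H).
  by move=> /(allP hwE) /=; rewrite inE andbC.
have len0 (s : seq (V * V)) : {subset s <= path_arcs (x :: w)} ->
    0 <= \sum_(a <- s) len a.
  by move=> hs; rewrite big_seq sumr_ge0// => a /hs/wE/andP[/hlen/ltW].
(* Shortening inside the graph formed by the arcs of the walk makes the two lengths comparable. *)
pose e' : rel V := fun i j => (i, j) \in path_arcs (x :: w).
have : path e' x w by rewrite -path_arcs_all; apply/allP.
case/shortenP => w' hw' uw' sw yH hint.
have w'w : {subset path_arcs (x :: w') <= path_arcs (x :: w)}.
  by move: hw'; rewrite -path_arcs_all => /allP.
have : \sum_(a <- path_arcs (x :: w')) len a <=
       \sum_(a <- path_arcs (x :: w)) len a.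
  apply: sum_uniq_sub => //; first exact: path_arcs_uniq.
  by move=> a /wE/andP[/hlen/ltW].
move=> /(ler_wpM2l r0); apply: le_trans.
case/lastP: w' => [|s y] in hw' uw' sw yH hint w'w *.
  (* The walk is closed and shortens to a single vertex. *)
  by rewrite /= subrr mulr_ge0// len0.
rewrite last_rcons in yH hint *; apply: hslope.
apply/and5P; split=> //.
- rewrite /directed_path uw' /=; apply/allP => a /w'w/wE/andP[]//.
- have [a aw] : exists a, a \in path_arcs (x :: rcons s y).
    by case: (s) => [|z s']; eexists; apply: mem_head.
  apply/negP => /allP/(_ a aw) /=; have := w'w a aw.
  by move=> /wE/andP[_ /negPf->].
apply/allP => i is_; apply/negP => iH.
have := hint i (sw i _) iH; rewrite mem_rcons inE is_ orbT => /(_ isT) iy.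
by move: uw'; rewrite -iy cons_uniq rcons_uniq is_ andbF.
Qed.

(* The extension is the distance to H, with boundary values p, for the metric
   r * len on the arcs outside H, truncated at a large constant M. *)
Lemma potential_extension : exists2 y : V -> R,
  (forall i, i \in verts H -> y i = p i) &
  (forall a, a \in E :\: H -> drop y a <= r * len a).
Proof.
(* [M] dominates all values of [p], and keeps the infimum over a nonempty set at vertices from which
   no walk reaches [H]. *)
pose M := \sum_i `|p i|.
have pM i : `|p i| <= M by rewrite /M (bigD1 i)//= lerDl sumr_ge0.
pose walk j w := [/\ path arc j w, last j w \in verts H &
  forall i, i \in w -> i \in verts H -> i = last j w].
pose S j : set R := [set v | v = M \/ exists2 w, walk j w &
  v = p (last j w) + r * \sum_(a <- path_arcs (j :: w)) len a]%classic.
have S_lb j v : S j v -> - M <= v.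
  case=> [->|[w [hw _ _] ->]]; first by rewrite lerNl (@le_trans _ _ 0) ?oppr_le0 ?sumr_ge0.
  have : 0 <= r * \sum_(a <- path_arcs (j :: w)) len a.
    rewrite mulr_ge0// big_seq sumr_ge0// => a aw.
    have /allP/(_ a aw) : all (mem (E :\: H)) (path_arcs (j :: w)).
      by rewrite path_arcs_all.
    by move=> /setDP[/hlen/ltW].
  have := pM (last j w); rewrite ler_norml => /andP[h _]; lra.
have S_hlb j : has_lbound (S j) by exists (- M) => v /S_lb.
have S_n0 j : (S j !=set0)%classic by exists M; left.
pose y j := if j \in verts H then p j else inf (S j).
exists y => [i iH|[i j] aF]; first by rewrite /y iH.
have aE : (i, j) \in E by move: aF; rewrite inE => /andP[].
have l0 : 0 <= r * len (i, j) by rewrite mulr_ge0// ltW// hlen.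
rewrite /drop /= lerBlDr /y; case: ifPn => iH; case: ifPn => jH.
- have := @walk_slope i [:: j] _ iH jH; rewrite /= /arc aF => /(_ isT).
  rewrite /path_arcs /= big_cons big_nil addr0 lerBlDr; apply.
  by move=> k; rewrite inE => /eqP.
(* The arc leaves [H]: put in front of a walk from [j] back to [H], it gives a walk between vertices
   of [H], to which [walk_slope] applies. *)
- rewrite -lerBlDl; apply: lb_le_inf => // v [->|[w [hw lH wi] ->]].
    by have := pM i; rewrite ler_norml => /andP[_]; lra.
  have := @walk_slope i (j :: w) _ iH lH; rewrite path_arcs_cons big_cons /=.
  rewrite {1}/arc aF => /(_ hw) h.
  suff : p i - p (last j w) <=
      r * (len (i, j) + \sum_(a <- path_arcs (j :: w)) len a).
    by rewrite mulrDr; lra.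
  apply: h => k; rewrite inE => /orP[/eqP->|]; last exact: wi.
  by rewrite (negPf jH).
- apply: ge_inf => //; right; exists [:: j].
    by split=> //=; [rewrite /arc aF|move=> k; rewrite inE => /eqP].
  by rewrite /path_arcs /= big_cons big_nil addr0 addrC.
rewrite -lerBlDl; apply: lb_le_inf => // v [->|[w [hw lH wi] ->]].
  apply: (@le_trans _ _ (inf (S i))); first by rewrite gerBl.
  by apply: ge_inf => //; left.
rewrite lerBlDl; apply: ge_inf => //; right; exists (j :: w).
  split=> //=; first by rewrite {1}/arc aF.
  move=> k; rewrite inE => /orP[/eqP->|]; last exact: wi.
  by rewrite (negPf jH).
by rewrite path_arcs_cons big_cons /=; ring.
Qed.
End Extension.

(** * Cut estimates for almost conserved flows *)

Section Cut.
Variables (R : realType) (V : finType).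
Local Notation n := (#|V|%:R : R).

(** Pigeonhole: the [n + 1] disjoint open intervals of length [g] that follow each other from [A] on
    cannot all contain one of the [n] values of [q]. *)
Lemma value_gap (q : V -> R) (A g : R) : 0 < g -> exists theta : R,
  [/\ A <= theta, theta + g <= A + (n + 1) * g &
      forall v, (q v <= theta) || (theta + g <= q v)].
Proof.
move=> g0; apply: contrapT => hno.
have hv (k : 'I_(#|V|.+1)) : exists v,
    (A + k%:R * g < q v) && (q v < A + k%:R * g + g).
  apply: contrapT => hk; apply: hno; exists (A + k%:R * g); split.
  - by rewrite lerDl mulr_ge0 ?ler0n// ltW.
  - rewrite -addrA lerD2l -{2}(mul1r g) -mulrDl ler_wpM2r ?(ltW g0)// lerD2r.
    by rewrite ler_nat -ltnS.
  - move=> v; rewrite -implyNb -ltNge; apply/implyP => h1.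
    by rewrite leNgt; apply/negP => h2; apply: hk; exists v; rewrite h1.
have [f hf] := choice hv.
have finj : injective f.
  have le (k l : 'I_(#|V|.+1)) : f k = f l -> (k <= l)%N.
    move=> kl; rewrite leqNgt; apply/negP => lk.
    have /andP[h1 _] := hf k; have /andP[_ h2] := hf l; rewrite kl in h1.
    have : (l%:R + 1 : R) <= k%:R by rewrite natr1 ler_nat.
    move=> /(ler_wpM2r (ltW g0)); rewrite mulrDl; lra.
  by move=> k l kl; apply/val_inj/eqP; rewrite eqn_leq !le.
by have := leq_card f finj; rewrite card_ord ltnn.
Qed.

(** The net outflow from [A] is the total divergence over [A], and also minus the total divergence
    over the complement. One of the two sides avoids [W], so the outflow through [e] exceeds the
    inflow by at most [n * eps]. *)
Lemma cut_flow (F : {set V * V}) (W : {set V}) (rho : V * V -> R) (A : pred V)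
    (eps K : R) e :
  loopless F -> (forall a, a \in F -> 0 <= rho a) ->
  (forall i, i \notin W -> `|divergence F rho i| <= eps) ->
  (forall v, A v -> v \notin W) \/ (forall v, ~~ A v -> v \notin W) ->
  0 <= eps -> 0 <= K ->
  (forall a, a \in F -> ~~ A a.1 -> A a.2 -> rho a <= K) ->
  e \in F -> A e.1 -> ~~ A e.2 -> rho e <= n * eps + #|F|%:R * K.
Proof.
move=> hF rho0 hdiv hW eps0 K0 hK eF e1 e2.
pose chi v : R := (A v)%:R.
have : \sum_(a in F) drop chi a * rho a <= n * eps.
  have -> : n * eps = \sum_(i : V) eps by rewrite sumr_const mulr_natl.
  have bnd (c : V -> R) : (forall v, v \in W -> c v = 0) ->
     (forall v, `|c v| <= 1) -> \sum_i c i * divergence F rho i <= \sum_(i : V) eps.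
    move=> c0 c1; apply: ler_sum => i _.
    case: (boolP (i \in W)) => [/c0->|/hdiv h]; first by rewrite mul0r.
    apply: (le_trans (ler_norm _)); rewrite normrM -[leRHS]mul1r.
    by apply: ler_pM.
  case: hW => hW.
    rewrite -sum_divergence//; apply: bnd => v.
      by move=> vW; rewrite /chi; case: (boolP (A v)) => // /hW; rewrite vW.
    by rewrite /chi; case: (A v); rewrite ?normr1 ?normr0.
  (* Minus the indicator of the complement has the same drops as [chi], and it vanishes on [W]. *)
  rewrite (eq_bigr (fun a => drop (fun v => chi v - 1) a * rho a)); last first.
    by move=> a _; rewrite /drop; congr (_ * _); ring.
  rewrite -sum_divergence//; apply: bnd => v.
    by move=> vW; rewrite /chi; case: (boolP (A v)) => [|/hW]; rewrite ?subrr ?vW.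
  by rewrite /chi; case: (A v); rewrite ?subrr ?sub0r ?normrN ?normr1 ?normr0.
have : rho e - #|F|%:R * K <= \sum_(a in F) drop chi a * rho a.
  have -> : #|F|%:R * K = \sum_(a in F) K by rewrite sumr_const mulr_natl.
  have -> : rho e = \sum_(a in F) (a == e)%:R * rho a.
    rewrite (bigD1 e)//= eqxx mul1r big1 ?addr0// => a /andP[_ /negPf->].
    by rewrite mul0r.
  rewrite -sumrB; apply: ler_sum => a aF; have ra := rho0 a aF; rewrite /drop /chi.
  case: eqVneq => [->|_] /=; first by rewrite e1 (negPf e2) subr0 mul1r gerBl.
  case: (boolP (A a.1)) => a1; case: (boolP (A a.2)) => a2 /=; try lra.
  have := hK a aF a1 a2; lra.
lra.
Qed.

(* By pigeonhole there is a level theta between q e.2 and q e.1, outside the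
   range of q on W, with no value of q in ]theta, theta + g[; cut there. *)
Lemma potential_cut (F : {set V * V}) (W : {set V}) (rho : V * V -> R) (q : V -> R)
    (C eps K g : R) e :
  loopless F -> (forall a, a \in F -> 0 <= rho a) ->
  (forall i, i \notin W -> `|divergence F rho i| <= eps) ->
  (forall i, i \in W -> `|q i| <= C) -> 0 <= C -> 0 <= eps -> 0 <= K -> 0 < g ->
  (forall a, a \in F -> drop q a <= - g -> rho a <= K) ->
  e \in F -> 2 * C + 2 * (n + 1) * g <= drop q e ->
  rho e <= n * eps + #|F|%:R * K.
Proof.
move=> hF rho0 hdiv hq C0 eps0 K0 g0 hK eF he.
have ng : 0 <= (n + 1) * g by rewrite mulr_ge0 ?(ltW g0)// addr_ge0.
have he' : 2 * C + 2 * ((n + 1) * g) <= q e.1 - q e.2 by rewrite mulrA; exact: he.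
(* If [q e.1] is well above [C], the level is sought above [C] and [q e.2], so the upper side avoids
   [W]. Otherwise [q e.2] is well below [- C], and a level below [- C] and [q e.1] makes the lower
   side avoid [W]. *)
pose A := if C + (n + 1) * g <= q e.1 then Num.max C (q e.2)
          else Num.min (- C) (q e.1) - (n + 1) * g.
have [theta [h1 h2 h3]] := value_gap q A g0.
apply: (cut_flow (A := fun v => theta + g <= q v) hF rho0 hdiv _ eps0 K0 _ eF).
- move: h1 h2; rewrite /A; case: (leP (C + (n + 1) * g) (q e.1)) => hc h1 h2.
    left=> v hv; apply/negP => /hq; rewrite ler_norml => /andP[_].
    by move: h1; rewrite ge_max => /andP[h1 _]; lra.
  right=> v hv; apply/negP => /hq; rewrite ler_norml => /andP[h4 _].
  have := h3 v; rewrite (negPf hv) orbF => h5.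
  have : Num.min (- C) (q e.1) <= - C by rewrite ge_min lexx.
  lra.
- move=> a aF a1 a2; apply: hK => //; rewrite /drop.
  by have := h3 a.1; rewrite (negPf a1) orbF; lra.
- apply: (le_trans h2); rewrite /A; case: (leP (C + (n + 1) * g) (q e.1)) => hc.
    by rewrite -lerBrDr ge_max; apply/andP; split; lra.
  by rewrite subrK ge_min lexx orbT.
rewrite -ltNge; apply: (@le_lt_trans _ _ theta); last by rewrite ltrDl.
apply: (le_trans _ h1); rewrite /A; case: (leP (C + (n + 1) * g) (q e.1)) => hc.
  by rewrite le_max lexx orbT.
by rewrite lerBrDr le_min; apply/andP; split; lra.
Qed.
End Cut.

(** * Derivatives and exponential decay *)

Section Derivative.
Variable R : realType.
Implicit Types (f g : R -> R) (t : R).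

Lemma is_derive_of_quotient f t df :
  (forall eps, 0 < eps -> exists2 delta, 0 < delta & forall s, s != t ->
     `|s - t| < delta -> `|df - (f s - f t) / (s - t)| < eps) ->
  is_derive t (1 : R) f df.
Proof.
move=> hf.
have cv : (h^-1 *: ((f \o shift t) (h *: (1 : R)) - f t) @[h --> 0^'] --> df)%classic.
  apply/cvgrPdist_lt => eps /hf[delta d0 hd].
  near=> h; have h0 : h != 0 by near: h; exact: nbhs_dnbhs_neq.
  have hlt : `|h| < delta by near: h; exact: dnbhs0_lt.
  have := hd (h + t); rewrite addrK => /(_ _ hlt).
  rewrite /= /shift /= -[X in (_ != X)]add0r (inj_eq (addIr t)) => /(_ h0).
  by rewrite mulrC (_ : h *: 1 = h) // /GRing.scale /= mulr1.
apply: DeriveDef; first by apply/cvg_ex; exists df.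
by apply/cvg_lim.
Unshelve. all: by end_near.
Qed.

Lemma has_derivative_quotient (D : set R) f t df : has_derivative_in D f t df ->
  forall eps, 0 < eps -> exists2 delta, 0 < delta & forall s, D s -> s != t ->
     `|s - t| < delta -> `|df - (f s - f t) / (s - t)| < eps.
Proof.
move=> /cvgrPdist_lt h eps /h; rewrite near_withinE /dnbhs near_withinE.
move=> /nbhs_ballP[delta d0 hd]; exists delta => // s Ds st sd.
by apply: hd => //; rewrite /ball /= distrC.
Qed.

(* Extending a function linearly to the left of 0 makes a one-sided derivative
   at 0 two-sided. *)
Definition extend_left f (d : R) : R -> R :=
  fun s => if s < 0 then f 0 + s * d else f s.

Lemma extend_left_is_derive f d t dt : 0 <= t ->
  has_derivative_in `[0, +oo[%classic f 0 d ->
  has_derivative_in `[0, +oo[%classic f t dt -> (t = 0 -> dt = d) ->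
  is_derive t (1 : R) (extend_left f d) dt.
Proof.
move=> t0 h0 ht hd; apply: is_derive_of_quotient => eps eps0.
have [delta d0 hdelta] := has_derivative_quotient ht eps0.
rewrite /extend_left; have -> : (t < 0) = false by rewrite ltNge t0.
move: t0; rewrite le_eqVlt => /predU1P[t0|t0].
  exists delta => // s st sd; case: (ltP s 0) => s0.
    rewrite hd // -t0 addrAC subrr add0r subr0 mulrAC mulfV ?mul1r ?subrr ?normr0//.
    by rewrite lt_eqF.
  by apply: hdelta => //; rewrite /= in_itv /= s0.
(* Points closer than [t] to [t] are positive, and there the extension changes nothing. *)
exists (Num.min delta t); first by rewrite lt_min d0 t0.
move=> s st; rewrite lt_min => /andP[sd st'].
have s0 : 0 < s.
  by move: st'; rewrite ltr_norml => /andP[h _]; lra.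
have -> : (s < 0) = false by rewrite ltNge (ltW s0).
apply: hdelta => //.
by rewrite /= in_itv /= (ltW s0).
Qed.

Lemma is_derive_add f g t df dg : is_derive t (1 : R) f df ->
  is_derive t (1 : R) g dg -> is_derive t (1 : R) (fun s => f s + g s) (df + dg).
Proof. exact: is_deriveD. Qed.

Lemma is_derive_cstM c f t df : is_derive t (1 : R) f df ->
  is_derive t (1 : R) (fun s => c * f s) (c * df).
Proof. by move=> h; exact: is_deriveZ. Qed.

Lemma is_derive_mul f g t df dg : is_derive t (1 : R) f df ->
  is_derive t (1 : R) g dg ->
  is_derive t (1 : R) (fun s => f s * g s) (f t * dg + g t * df).
Proof. exact: is_deriveM. Qed.

Lemma is_derive_bigsum (I : Type) (r : seq I) (P : pred I) (F : I -> R -> R)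
    (dF : I -> R) t : (forall i, P i -> is_derive t (1 : R) (F i) (dF i)) ->
  is_derive t (1 : R) (fun s => \sum_(i <- r | P i) F i s) (\sum_(i <- r | P i) dF i).
Proof.
move=> h; elim: r => [|i r IH].
  under eq_fun do rewrite big_nil; rewrite big_nil; exact: is_derive_cst.
under eq_fun do rewrite big_cons; rewrite big_cons.
by case: ifPn => // Pi; apply: is_derive_add => //; exact: h.
Qed.

Lemma is_derive_lnf f t df : 0 < f t -> is_derive t (1 : R) f df ->
  is_derive t (1 : R) (fun s => ln (f s)) (df / f t).
Proof.
move=> f0 h; have := is_derive1_comp (is_derive1_ln f0) h.
by rewrite mulrC.
Qed.

Lemma is_derive_expM c t :
  is_derive t (1 : R) (fun s => expR (c * s)) (c * expR (c * t)).
Proof.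
have h : is_derive t (1 : R) (fun s => c * s) c.
  have := is_derive_cstM c (is_derive_id t (1 : R)); rewrite mulr1; exact.
have := is_derive1_comp (is_derive_expR (c * t)) h.
by rewrite mulrC.
Qed.

Lemma derivative_le0 f (df : R -> R) (x y : R) : x <= y ->
  (forall t, x <= t <= y -> is_derive t (1 : R) f (df t)) ->
  (forall t, x <= t <= y -> df t <= 0) -> f y <= f x.
Proof.
move=> xy hf hd; apply: (@ler0_derive1_le_cc _ f x y) => //.
- move=> t; rewrite in_itv /= => /andP[/ltW h1 /ltW h2].
  by have [] := hf t; rewrite ?h1 ?h2.
- move=> t; rewrite in_itv /= => /andP[/ltW h1 /ltW h2].
  have ht : x <= t <= y by rewrite h1 h2.
  by have [_ h] := hf t ht; rewrite derive1E h hd.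
- apply: derivable_within_continuous => t; rewrite in_itv /= => ht.
  by have [] := hf t ht.
- by rewrite in_itv /= lexx andbT.
- by rewrite in_itv /= lexx.
Qed.

Lemma derivative_ge0 f (df : R -> R) (x y : R) : x <= y ->
  (forall t, x <= t <= y -> is_derive t (1 : R) f (df t)) ->
  (forall t, x <= t <= y -> 0 <= df t) -> f x <= f y.
Proof.
move=> xy hf hd; rewrite -lerN2.
apply: (@derivative_le0 (fun s => - f s) (fun s => - df s)) => // t ht.
  by have h := hf t ht; exact: is_deriveN.
by rewrite oppr_le0 hd.
Qed.

Lemma derivative_eq0 f (x y : R) : x <= y ->
  (forall t, x <= t <= y -> is_derive t (1 : R) f 0) -> f y = f x.
Proof.
move=> xy hf; apply/eqP; rewrite eq_le.
by rewrite (derivative_le0 xy hf) // (derivative_ge0 xy hf).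
Qed.
Lemma continuous_at_eps (g : R -> R) t (dg eps : R) :
  is_derive t (1 : R) g dg -> 0 < eps ->
  exists2 delta, 0 < delta & forall s, `|s - t| < delta -> `|g s - g t| < eps.
Proof.
move=> [h _] eps0.
have /differentiable_continuous : differentiable g t by apply/derivable1_diffP.
move=> /cvgrPdist_lt/(_ eps eps0)/nbhs_ballP[delta d0 hd].
by exists delta => // s st; rewrite distrC; apply: hd; rewrite /ball /= distrC.
Qed.
End Derivative.

(** * Boundedness and exponential decay on the half-line *)

Section Asymptotics.
Variable R : realType.
Implicit Types f g : R -> R.

Definition bounded_on_ray f := exists C, forall t, 0 <= t -> `|f t| <= C.
Definition exp_decay f :=
  exists a C, 0 < a /\ forall t, 0 <= t -> `|f t| <= C * expR (- a * t).

Lemma bounded_le f g : bounded_on_ray g ->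
  (forall t, 0 <= t -> `|f t| <= `|g t|) -> bounded_on_ray f.
Proof. by move=> [C hC] h; exists C => t t0; rewrite (le_trans (h t t0)) ?hC. Qed.

Lemma bounded_cst c : bounded_on_ray (fun=> c).
Proof. by exists `|c|. Qed.

Lemma bounded_add f g : bounded_on_ray f -> bounded_on_ray g ->
  bounded_on_ray (fun t => f t + g t).
Proof.
move=> [C hC] [D hD]; exists (C + D) => t t0.
by rewrite (le_trans (ler_normD _ _)) // lerD ?hC ?hD.
Qed.

Lemma bounded_mul f g : bounded_on_ray f -> bounded_on_ray g ->
  bounded_on_ray (fun t => f t * g t).
Proof.
move=> [C hC] [D hD]; exists (C * D) => t t0.
by rewrite normrM ler_pM ?hC ?hD.
Qed.

Lemma bounded_sub f g : bounded_on_ray f -> bounded_on_ray g ->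
  bounded_on_ray (fun t => f t - g t).
Proof.
move=> hf hg; apply: bounded_add => //.
by apply: (bounded_le hg) => t _; rewrite normrN.
Qed.

Lemma bounded_sum (I : Type) (r : seq I) (P : pred I) (F : I -> R -> R) :
  (forall i, P i -> bounded_on_ray (F i)) ->
  bounded_on_ray (fun t => \sum_(i <- r | P i) F i t).
Proof.
move=> h; elim: r => [|i r IH].
  by under eq_fun do rewrite big_nil; exact: bounded_cst.
by under eq_fun do rewrite big_cons; case: (boolP (P i)) => // Pi; apply/bounded_add/IH/h.
Qed.

Lemma bounded_all (I : finType) (P : pred I) (F : I -> R -> R) :
  (forall i, P i -> bounded_on_ray (F i)) ->
  exists2 C, 0 <= C & forall i t, P i -> 0 <= t -> `|F i t| <= C.
Proof.
move=> h; have [C hC] : bounded_on_ray (fun t => \sum_(i | P i) `|F i t|).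
  by apply: bounded_sum => i /h hi; apply: (bounded_le hi) => t _; rewrite normr_id.
have C0 : 0 <= C by apply: le_trans (hC 0 _).
exists C => // i t Pi t0; apply: (le_trans _ (hC t t0)).
rewrite [leRHS]ger0_norm ?sumr_ge0// (bigD1 i)//= lerDl.
exact: sumr_ge0.
Qed.

Lemma exp_decay_le f g : exp_decay g ->
  (forall t, 0 <= t -> `|f t| <= `|g t|) -> exp_decay f.
Proof.
move=> [a [C [a0 hC]]] h; exists a, C; split=> // t t0.
by rewrite (le_trans (h t t0)) ?hC.
Qed.

Lemma exp_decay0 : exp_decay (fun=> 0).
Proof. by exists 1, 0; split=> // t _; rewrite mul0r normr0. Qed.

Lemma exp_decay_add f g : exp_decay f -> exp_decay g ->
  exp_decay (fun t => f t + g t).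
Proof.
have mono (a c t C : R) : a <= c -> 0 <= t -> 0 <= C ->
    C * expR (- c * t) <= C * expR (- a * t).
  by move=> ac t0 C0; rewrite ler_wpM2l// ler_expR ler_wpM2r// lerN2.
move=> [a [C [a0 hC]]] [c [D [c0 hD]]].
have C0 : 0 <= C.
  by have := hC 0 (lexx _); rewrite mulr0 expR0 mulr1; apply: le_trans.
have D0 : 0 <= D.
  by have := hD 0 (lexx _); rewrite mulr0 expR0 mulr1; apply: le_trans.
exists (Num.min a c), (C + D); split=> [|t t0]; first by rewrite lt_min a0 c0.
rewrite (le_trans (ler_normD _ _))// mulrDl lerD//.
  by rewrite (le_trans (hC t t0))// mono// ge_min lexx.
by rewrite (le_trans (hD t t0))// mono// ge_min lexx orbT.
Qed.

Lemma exp_decay_mul f g : exp_decay f -> bounded_on_ray g ->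
  exp_decay (fun t => f t * g t).
Proof.
move=> [a [C [a0 hC]]] [D hD]; exists a, (C * D); split=> // t t0.
by rewrite normrM mulrAC ler_pM ?hC ?hD.
Qed.

Lemma exp_decay_sub f g : exp_decay f -> exp_decay g ->
  exp_decay (fun t => f t - g t).
Proof.
move=> hf hg; apply: exp_decay_add => //.
by apply: (exp_decay_le hg) => t _; rewrite normrN.
Qed.

Lemma exp_decay_sum (I : Type) (r : seq I) (P : pred I) (F : I -> R -> R) :
  (forall i, P i -> exp_decay (F i)) ->
  exp_decay (fun t => \sum_(i <- r | P i) F i t).
Proof.
move=> h; elim: r => [|i r IH].
  by under eq_fun do rewrite big_nil; exact: exp_decay0.
by under eq_fun do rewrite big_cons; case: (boolP (P i)) => // Pi;
  apply/exp_decay_add/IH/h.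
Qed.

Lemma exp_decay_exp (a c : R) : 0 < a -> exp_decay (fun t => c * expR (- a * t)).
Proof.
move=> a0; exists a, `|c|; split=> // t _.
by rewrite normrM (ger0_norm (expR_ge0 _)).
Qed.

Lemma exp_decay_sqr f : exp_decay (fun t => f t ^+ 2) -> exp_decay f.
Proof.
move=> [a [C [a0 hC]]]; have C0 : 0 <= C.
  by have := hC 0 (lexx _); rewrite mulr0 expR0 mulr1; apply: le_trans.
(* [C + 1] replaces the square root of [C], since [C <= (C + 1)^2]. *)
exists (a / 2), (C + 1); split=> [|t t0]; first by lra.
rewrite -(@ler_pXn2r _ 2)// ?nnegrE ?normr_ge0 ?mulr_ge0 ?expR_ge0 ?addr_ge0//.
rewrite -normrX exprMn -expRM_natl (_ : 2%:R * _ = - a * t); last by field.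
apply: (le_trans (hC t t0)); rewrite ler_wpM2r ?expR_ge0//; nra.
Qed.

Lemma exp_decay_all (I : finType) (P : pred I) (F : I -> R -> R) :
  (forall i, P i -> exp_decay (F i)) ->
  exists a T, [/\ 0 < a, 0 <= T &
    forall t, T <= t -> forall i, P i -> `|F i t| <= expR (- a * t)].
Proof.
move=> h; have [a [C [a0 hC]]] : exp_decay (fun t => \sum_(i | P i) `|F i t|).
  by apply: exp_decay_sum => i /h hi; apply: (exp_decay_le hi) => t _; rewrite normr_id.
have C0 : 0 <= C.
  by have := hC 0 (lexx _); rewrite mulr0 expR0 mulr1; apply: le_trans.
have T0 : 0 <= 2 * C / a by rewrite divr_ge0 ?mulr_ge0// ltW.
(* Half of the rate absorbs the constant: [e^{a t / 2} >= 1 + a t / 2 >= C] once [t >= 2 C / a]. *)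
exists (a / 2), (2 * C / a); split=> // [|t tT i Pi]; first by lra.
have t0 : 0 <= t by apply: le_trans tT.
apply: (@le_trans _ _ (C * expR (- a * t))).
  apply: (le_trans _ (hC t t0)); rewrite [leRHS]ger0_norm ?sumr_ge0// (bigD1 i)//= lerDl.
  exact: sumr_ge0.
have -> : - (a / 2) * t = (a / 2) * t + - a * t by field.
rewrite expRD ler_wpM2r ?expR_ge0//.
apply: (@le_trans _ _ (1 + a / 2 * t)); last exact: expR_ge1Dx.
move: tT; rewrite ler_pdivrMr//; lra.
Qed.
End Asymptotics.

(** * The Physarum dynamics *)

Section Statics.
Variables (R : realType) (V : finType) (E : {set V * V}).
Variables (len : V * V -> R) (b : V -> R) (f : V * V -> R).
Local Notation Hhat := (optimal_set E len b).
Hypothesis hG : connected_digraph E.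
Hypothesis hlen : forall a, a \in E -> 0 < len a.
Hypothesis f_opt : optimal_flow E len b f.
Hypothesis f_supp : forall a, a \in E -> if a \in Hhat then 0 < f a else f a == 0.
Hypothesis conn : connected_on (verts Hhat) Hhat.

Let hE : loopless E. Proof. by case: hG. Qed.

Lemma full_flow_ge0 a : a \in E -> 0 <= f a.
Proof. by have [[_ h] _] := f_opt; exact: h. Qed.

(** Up to a constant independent of [s], this is the relative entropy of [f] with respect to [s],
    weighted by [len], plus twice the cost of [s]. *)
Definition entropy (s : V * V -> R) : R :=
  \sum_(a in E) (- (f a * len a) * ln (s a) + 2 * (len a * s a)).

(** The right side is minimal at [s = g]; this is [ln x <= x - 1] at [x = s / g]. *)
Lemma entropy_term_ge (s g : R) : 0 < s -> 0 <= g ->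
  g * (1 - ln g) <= s - g * ln s.
Proof.
move=> s0; rewrite le_eqVlt => /predU1P[<-|g0].
  by rewrite !mul0r subr0 ltW.
have h : ln (s / g) <= s / g - 1.
  have := @le_ln1Dx R (s / g - 1); rewrite addrCA subrr addr0; apply.
  have := divr_gt0 s0 g0; lra.
move: h; rewrite ln_div ?posrE// => /(ler_wpM2l (ltW g0)).
rewrite mulrBr [X in _ <= X]mulrBr mulrCA mulfV ?gt_eqF//; lra.
Qed.

(** One of the two copies of [len * s] compensates the logarithm, so every term is bounded below,
    and hence above on a sublevel set. The other copy then bounds [s] above, and the logarithm
    bounds [s] below where [f > 0]. *)
Lemma entropy_sublevel (C0 : R) : exists c M : R, [/\ 0 < c, 0 <= M &
  forall s, (forall a, a \in E -> 0 < s a) -> entropy s <= C0 ->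
    (forall a, a \in E -> s a <= M) /\ (forall a, a \in Hhat -> c <= s a)].
Proof.
pose k a := len a * (f a * (1 - ln (f a))).
pose C1 := `|C0| + \sum_(a in E) `|k a|.
have K0 : 0 <= \sum_(a in E) `|k a| by rewrite sumr_ge0.
have C10 : 0 <= C1 by rewrite addr_ge0.
exists (expR (- \sum_(a in Hhat) C1 / (f a * len a))), (\sum_(a in E) C1 / len a).
have HE a : a \in Hhat -> a \in E by apply/fintype.subsetP/optimal_set_sub.
have fl a : a \in Hhat -> 0 < f a * len a.
  by move=> aH; rewrite mulr_gt0 ?hlen ?HE//; have := f_supp (HE a aH); rewrite aH.
split=> [||s s0 hs]; first exact: expR_gt0.
  by rewrite sumr_ge0// => a aE; rewrite divr_ge0// ltW// hlen.
have term a : a \in E ->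
    k a + len a * s a <= - (f a * len a) * ln (s a) + 2 * (len a * s a).
  move=> aE; have := entropy_term_ge (s0 a aE) (full_flow_ge0 aE).
  by move=> /(ler_wpM2l (ltW (hlen aE))); rewrite -/(k a) mulrBr; lra.
have one a : a \in E ->
    - (f a * len a) * ln (s a) + 2 * (len a * s a) <= C1 - `|k a|.
  move=> aE; have : entropy s <= `|C0| by apply: (le_trans hs); exact: ler_norm.
  rewrite /entropy /C1 (bigD1 a)//= (bigD1 a (F := fun c => `|k c|))//=.
  have : \sum_(i in E | i != a) - `|k i| <=
     \sum_(i in E | i != a) (- (f i * len i) * ln (s i) + 2 * (len i * s i)).
    apply: ler_sum => i /andP[iE _]; apply: le_trans (term i iE).
    have : - `|k i| <= k i by rewrite lerNl -normrN ler_norm.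
    have : 0 <= len i * s i by rewrite mulr_ge0// ltW ?hlen ?s0.
    lra.
  rewrite sumrN; lra.
split=> a aE.
  have : len a * s a <= C1.
    have := one a aE; have := term a aE.
    have : - `|k a| <= k a by rewrite lerNl -normrN ler_norm.
    lra.
  rewrite mulrC -ler_pdivlMr ?hlen// => /le_trans; apply.
  rewrite (bigD1 a)//= lerDl sumr_ge0// => i /andP[iE _].
  by rewrite divr_ge0// ltW// hlen.
have h1 := one a (HE a aE); have sa := s0 a (HE a aE).
have : - ln (s a) <= C1 / (f a * len a).
  rewrite ler_pdivlMr ?fl//.
  have : 0 <= len a * s a by rewrite mulr_ge0// ltW ?hlen ?HE.
  have := normr_ge0 (k a); lra.
move=> h2; rewrite -[leRHS]lnK ?posrE// ler_expR lerNl; apply: (le_trans h2).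
rewrite (bigD1 a)//= lerDl sumr_ge0// => i /andP[iH _].
by rewrite divr_ge0// ltW// fl.
Qed.

Lemma divergence_current s q i :
  divergence E (current len s q) i =
  divergence E (fun a => s a / len a * drop q a) i.
Proof. by apply: eq_bigr => a _; rewrite /current /drop; congr (_ * _); ring. Qed.

(** Sources and sinks lie in the optimal set, so the maximum principle applies off it. *)
Lemma potential_max s q root m : (forall a, a \in E -> 0 < s a) ->
  (forall i, divergence E (current len s q) i = b i) -> root \in verts Hhat ->
  (forall i, i \in verts Hhat -> q i <= m) -> forall i, q i <= m.
Proof.
move=> s0 hq rH hm; apply: (max_principle (c := fun a => s a / len a)
  hG _ rH _ hm) => [a aE|i iH].
  by rewrite divr_gt0 ?s0 ?hlen.
by rewrite -divergence_current hq; exact: optimal_balanced f_opt f_supp _ iH.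
Qed.

Lemma potential_min s q root m : (forall a, a \in E -> 0 < s a) ->
  (forall i, divergence E (current len s q) i = b i) -> root \in verts Hhat ->
  (forall i, i \in verts Hhat -> m <= q i) -> forall i, m <= q i.
Proof.
move=> s0 hq rH hm i; rewrite -lerN2.
have N a : drop (fun j => - q j) a = - drop q a by rewrite /drop; ring.
apply: (max_principle (p := fun j => - q j) (c := fun a => s a / len a)
  hG _ rH) => [a aE|j jH|j jH].
- by rewrite divr_gt0 ?s0 ?hlen.
- rewrite (_ : divergence _ _ _ = - divergence E (current len s q) j).
    by rewrite hq (optimal_balanced f_opt f_supp jH) oppr0.
  rewrite divergence_current /divergence -sumrN.
  by apply: eq_bigr => a _; rewrite N !mulrN.
by rewrite lerN2 hm.
Qed.

(** The minimum of [q] over the optimal set bounds [q] below everywhere, so it is the global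
    minimum. *)
Lemma potential_zero s q root : (forall a, a \in E -> 0 < s a) ->
  (forall i, divergence E (current len s q) i = b i) -> root \in verts Hhat ->
  min_zero_on [set: V] q -> exists2 i, i \in verts Hhat & q i = 0.
Proof.
move=> s0 hq rH [q0 [j _ qj]].
case: (@arg_minP _ _ _ root (fun i => i \in verts Hhat) q rH) => i iH hi.
exists i => //; apply/eqP; rewrite eq_le q0 ?finset.in_setT// andbT -qj.
exact: (potential_min s0 hq rH hi).
Qed.

(** The energy of [q] equals the sum of [f * drop q] over the optimal set. Young's inequality
    absorbs that sum into half of the energy, which bounds the drops there; chains and the maximum
    principle do the rest. *)
Lemma potential_bounded root (c : R) : root \in verts Hhat -> 0 < c ->
  exists2 M : R, 0 <= M & forall s q, (forall a, a \in E -> 0 < s a) ->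
    (forall a, a \in Hhat -> c <= s a) ->
    (forall i, divergence E (current len s q) i = b i) ->
    min_zero_on [set: V] q -> forall i, 0 <= q i <= M.
Proof.
move=> rH c0; have [chi hchi] := connected_chains R conn rH.
have HE a : a \in Hhat -> a \in E by apply/fintype.subsetP/optimal_set_sub.
(* The remainder in Young's inequality [f d <= c d^2 / (2 len) + f^2 len / (2 c)]. *)
pose S := \sum_(a in Hhat) f a ^+ 2 * len a / (2 * c).
have S0 : 0 <= S.
  rewrite sumr_ge0// => a /HE/hlen/ltW la.
  by rewrite divr_ge0// mulr_ge0 ?sqr_ge0// ltW.
(* From [d^2 <= 2 len S / c] and [|d| <= 1 + d^2]. *)
pose D a := 1 + 2 * len a * S / c.
have D0 a : a \in Hhat -> 0 <= D a.
  by move=> /HE/hlen/ltW la; rewrite addr_ge0// divr_ge0 ?mulr_ge0// ltW.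
pose N := \sum_i \sum_(a in Hhat) `|chi i a| * D a.
have N0 : 0 <= N.
  by rewrite sumr_ge0// => i _; rewrite sumr_ge0// => a /D0; exact: mulr_ge0.
(* One [N] leads from a zero of [q] in the optimal set to the root, the other from the root to any
   vertex. *)
exists (2 * N) => [|s q s0 sc hq hmin]; first by rewrite mulr_ge0.
pose d := drop q.
have energy : \sum_(a in E) s a / len a * d a ^+ 2 = \sum_(a in Hhat) f a * d a.
  rewrite -(optimal_sum_arcs f_supp) (flow_cost_div (b := b) hE); last by case: f_opt => [[]].
  under [RHS]eq_bigr do rewrite -hq.
  rewrite sum_divergence//; apply: eq_bigr => a _.
  by rewrite /current -/(drop q a) /d; ring.
have low : \sum_(a in Hhat) c / len a * d a ^+ 2 <=
    \sum_(a in E) s a / len a * d a ^+ 2.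
  rewrite [leRHS](big_setID Hhat) /= (finset.setIidPr (optimal_set_sub _ _ _)).
  rewrite -[leLHS]addr0 lerD//.
    apply: ler_sum => a aH; rewrite ler_wpM2r ?sqr_ge0//.
    by rewrite ler_pM2r ?invr_gt0 ?hlen ?HE ?sc.
  rewrite sumr_ge0// => a /setDP[aE _].
  by rewrite mulr_ge0 ?sqr_ge0// divr_ge0// ltW ?s0 ?hlen.
have up : \sum_(a in Hhat) f a * d a <=
    \sum_(a in Hhat) (c / len a / 2 * d a ^+ 2 + f a ^+ 2 * len a / (2 * c)).
  apply: ler_sum => a /HE/hlen la; rewrite -subr_ge0.
  have -> : c / len a / 2 * d a ^+ 2 + f a ^+ 2 * len a / (2 * c) - f a * d a =
      (c * d a - f a * len a) ^+ 2 / (2 * c * len a).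
    by field; rewrite !gt_eqF.
  by rewrite divr_ge0 ?sqr_ge0// !mulr_ge0// ltW.
have half : \sum_(a in Hhat) c / len a / 2 * d a ^+ 2 <= S.
  move: up; rewrite big_split /= -/S => up.
  have : \sum_(a in Hhat) c / len a * d a ^+ 2 =
      2 * \sum_(a in Hhat) c / len a / 2 * d a ^+ 2.
    rewrite mulr_sumr; apply: eq_bigr => a /HE/hlen la.
    by field; rewrite gt_eqF.
  lra.
have dD a : a \in Hhat -> `|d a| <= D a.
  move=> aH; have la := hlen (HE a aH).
  have : c / len a / 2 * d a ^+ 2 <= S.
    apply: le_trans half; rewrite (bigD1 a)//= lerDl sumr_ge0// => i /andP[/HE/hlen li _].
    by rewrite mulr_ge0 ?sqr_ge0// !divr_ge0// ltW.
  have -> : c / len a / 2 * d a ^+ 2 = d a ^+ 2 * c / (2 * len a).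
    by field; rewrite gt_eqF.
  rewrite ler_pdivrMr ?mulr_gt0// -ler_pdivlMr// => h.
  have h2 : `|d a| <= 1 + `|d a| ^+ 2 by have := normr_ge0 (d a); nra.
  by apply: (le_trans h2); rewrite lerD2l -normrX ger0_norm ?sqr_ge0// (mulrC _ S).
have close i : i \in verts Hhat -> `|q i - q root| <= N.
  move=> iH; rewrite hchi// (le_trans (ler_norm_sum _ _ _))//.
  apply: (@le_trans _ _ (\sum_(a in Hhat) `|chi i a| * D a)).
    by apply: ler_sum => a aH; rewrite normrM ler_wpM2l// dD.
  rewrite /N [leRHS](bigD1 i)//= lerDl sumr_ge0// => j _.
  by rewrite sumr_ge0// => a /D0; exact: mulr_ge0.
have up' := potential_max s0 hq rH (m := q root + N).
have {}up' i : q i <= q root + N.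
  by apply: up' => j /close; rewrite ler_norml => /andP[_]; lra.
have [k kH qk] := potential_zero s0 hq rH hmin.
have := close k kH; rewrite qk ler_norml => /andP[h _] i.
have [-> //] := hmin; have := up' i; lra.
Qed.
End Statics.

(** * Lyapunov function, a priori bounds and positivity *)

Section Dynamics.
Variables (R : realType) (V : finType) (E : {set V * V}).
Variables (len : V * V -> R) (b : V -> R) (f : V * V -> R).
Local Notation Hhat := (optimal_set E len b).
Hypothesis hG : connected_digraph E.
Hypothesis hlen : forall a, a \in E -> 0 < len a.
Hypothesis f_opt : optimal_flow E len b f.
Hypothesis f_supp : forall a, a \in E -> if a \in Hhat then 0 < f a else f a == 0.
Hypothesis conn : connected_on (verts Hhat) Hhat.
Variable root : V.
Hypothesis root_in : root \in verts Hhat.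

Variables (sigma : R -> V * V -> R) (p : R -> V -> R).
Hypothesis sigma0 : forall a, a \in E -> 0 < sigma 0 a.
Hypothesis sigma_der : forall (t : R) a, 0 <= t -> a \in E ->
  is_derive t (1 : R) (sigma^~ a) (sigma t a * (drop (p t) a / len a - 1)).
Hypothesis kirchhoff : forall (t : R) i, 0 <= t ->
  divergence E (current len (sigma t) (p t)) i = b i.
Hypothesis p_min : forall t : R, 0 <= t -> min_zero_on [set: V] (p t).

Let hE : loopless E. Proof. by case: hG. Qed.
Let HE a : a \in Hhat -> a \in E.
Proof. exact/fintype.subsetP/optimal_set_sub. Qed.

Implicit Types t : R.

Definition imbalance i : R := divergence E (sigma 0) i - b i.

(** By Kirchhoff's law [B sigma - b] solves [D' = - D]. *)
Lemma divergence_sigma t i : 0 <= t ->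
  divergence E (sigma t) i = b i + expR (- t) * imbalance i.
Proof.
move=> t0; pose D s := divergence E (sigma s) i - b i.
suff h : expR (1 * t) * D t = expR (1 * 0) * D 0.
  move: h; rewrite mulr0 expR0 mul1r mul1r /D => h.
  rewrite /imbalance -h mulrA -expRD addNr expR0; ring.
apply: (derivative_eq0 (f := fun s => expR (1 * s) * D s) t0) => s /andP[s0 _].
have hD : is_derive s (1 : R) D (- D s).
  rewrite /D /divergence.
  have -> : - (\sum_(a in E) boundary R i a * sigma s a - b i) =
      \sum_(a in E) boundary R i a * (sigma s a * (drop (p s) a / len a - 1)) + 0.
    rewrite -(kirchhoff i s0) /divergence -sumrB -sumrN addr0.
    by apply: eq_bigr => a _; rewrite /current /drop; ring.
  apply: is_derive_add.
    apply: is_derive_bigsum => a aE; apply: is_derive_cstM; exact: sigma_der.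
have := is_derive_mul (is_derive_expM 1 s) hD.
by rewrite mulrN mulrA mulr1 mul1r mulrC addNr.
Qed.

Section Lyapunov.
Variable y : V -> R.
Hypothesis y_le : forall a, a \in E -> drop y a <= len a.
Hypothesis y_eq : forall a, a \in Hhat -> drop y a = len a.

(** By [divergence_sigma] the subtracted term is the pairing of [y] with [B sigma - b]: it corrects
    the entropy for conductivities that are not yet a flow. *)
Definition lyapunov t : R :=
  entropy E len f (sigma t) - (\sum_i y i * imbalance i) * expR (-1 * t).

(* With x = drop p / len, the derivative of the Lyapunov function is
   - sum sigma (len (x - 1)^2 + (len - drop y)). *)
Lemma lyapunov_le T : 0 <= T ->
  (forall t, 0 <= t <= T -> forall a, a \in E -> 0 < sigma t a) ->
  lyapunov T <= lyapunov 0.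
Proof.
move=> T0 pos; pose k := \sum_i y i * imbalance i.
pose x t a := drop (p t) a / len a.
pose dl t := \sum_(a in E) (- (f a * len a) * (sigma t a * (x t a - 1) / sigma t a)
   + 2 * (len a * (sigma t a * (x t a - 1)))) + (- k) * (-1 * expR (-1 * t)).
apply: (derivative_le0 (df := dl) T0) => t tT; have /andP[t0 _] := tT.
  rewrite /lyapunov /entropy -/k.
  under eq_fun do rewrite -mulNr.
  apply: is_derive_add; last by apply: is_derive_cstM; exact: is_derive_expM.
  apply: is_derive_bigsum => a aE; apply: is_derive_add.
    by apply: is_derive_cstM; apply: is_derive_lnf; [exact: pos|exact: sigma_der].
  by apply: is_derive_cstM; apply: is_derive_cstM; exact: sigma_der.
have s0 := pos t tT.
have kE : k * expR (-1 * t) = \sum_(a in E) drop y a * sigma t a - \sum_i y i * b i.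
  rewrite -sum_divergence// -sumrB /k mulr_suml; apply: eq_bigr => i _.
  by rewrite divergence_sigma// mulN1r; ring.
(* Complementary slackness: [y] is tight wherever [f] is nonzero. *)
have yb : \sum_i y i * b i = \sum_(a in E) f a * len a.
  rewrite -(flow_cost_div (b := b) (f := f) hE); last by case: f_opt => [[]].
  by rewrite !(optimal_sum_arcs f_supp); apply: eq_bigr => a /y_eq->.
have pb : \sum_i p t i * b i = \sum_(a in E) f a * drop (p t) a.
  by rewrite -(flow_cost_div (b := b) (f := f) hE)//; case: f_opt => [[]].
have pb' : \sum_i p t i * b i = \sum_(a in E) sigma t a * len a * x t a ^+ 2.
  under eq_bigr do rewrite -(kirchhoff _ t0).
  rewrite sum_divergence//; apply: eq_bigr => a /hlen la.
  by rewrite /current -/(drop (p t) a) /x; field; rewrite gt_eqF.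
have -> : dl t = \sum_(a in E) (- (f a * len a) + f a * drop (p t) a) * (-1)
  + 2 * \sum_(a in E) (len a * (sigma t a * (x t a - 1))) + k * expR (-1 * t).
  rewrite /dl big_split /= -mulr_sumr; congr (_ + _ + _); last by ring.
  apply: eq_bigr => a aE; have := s0 a aE; have := hlen aE => la sa.
  by rewrite /x; field; rewrite !gt_eqF.
rewrite -mulr_suml big_split /= sumrN -pb pb' kE yb.
have -> : forall A B C D : R, (- A + B) * -1 + 2 * C + (D - A) = D + 2 * C - B.
  by move=> A B C D; ring.
rewrite mulr_sumr -big_split -sumrB /=; apply: sumr_le0 => a aE.
have sa := s0 a aE; have la := hlen aE; have ya := y_le aE.
have -> : drop y a * sigma t a + 2 * (len a * (sigma t a * (x t a - 1))) -
   sigma t a * len a * x t a ^+ 2 =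
   - (sigma t a * (len a * (x t a - 1) ^+ 2 + (len a - drop y a))) by ring.
rewrite oppr_le0 mulr_ge0 ?(ltW sa)// addr_ge0 ?subr_ge0//.
by rewrite mulr_ge0 ?sqr_ge0// ltW.
Qed.

Lemma sigma_bounds : exists c M : R, [/\ 0 < c, 0 <= M &
  forall T, 0 <= T -> (forall t, 0 <= t <= T -> forall a, a \in E -> 0 < sigma t a) ->
  [/\ forall a, a \in E -> sigma T a <= M, forall a, a \in Hhat -> c <= sigma T a &
      forall i, 0 <= p T i <= M]].
Proof.
pose k := \sum_i y i * imbalance i.
have [c [M [c0 M0 h]]] := entropy_sublevel hlen f_opt f_supp (lyapunov 0 + `|k|).
have [N N0 hN] := potential_bounded hG hlen f_opt f_supp conn root_in c0.
exists c, (M + N); split=> // [|T T0 pos]; first exact: addr_ge0.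
have posT a : a \in E -> 0 < sigma T a by apply: pos; rewrite T0 lexx.
have [|sM sc] := h _ posT.
  have := lyapunov_le T0 pos; rewrite /lyapunov -/k => hl.
  have : k * expR (-1 * T) <= `|k|.
    apply: (le_trans (ler_norm _)); rewrite normrM (ger0_norm (expR_ge0 _)).
    by rewrite ler_piMr// -[leRHS]expR0 ler_expR mulN1r oppr_le0.
  lra.
split=> // [a aE|i]; first by have := sM a aE; lra.
have := hN (sigma T) (p T) posT sc (fun j => kirchhoff j T0) (p_min T0) i.
by case/andP=> -> /=; lra.
Qed.

(* Up to the first exit time tau, the bound on p from sigma_bounds, which does not
   depend on tau, makes ln sigma decrease at most linearly. *)
Lemma sigma_gt0 t a : 0 <= t -> a \in E -> 0 < sigma t a.
Proof.
pose bad t := 0 <= t /\ exists2 a, a \in E & sigma t a <= 0.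
suff no s : ~ bad s.
  move=> t0 aE; rewrite ltNge; apply/negP => h.
  by apply: (no t); split=> //; exists a.
move=> bads; pose B : set R := [set t | bad t]%classic; pose tau := inf B.
have Bn0 : (B !=set0)%classic by exists s.
have Blb : has_lbound B by exists 0 => r [].
have tau0 : 0 <= tau by apply: lb_le_inf => // r [].
have pos r : 0 <= r -> r < tau -> forall a, a \in E -> 0 < sigma r a.
  move=> r0 rt c cE; rewrite ltNge; apply/negP => h.
  by move: rt; rewrite ltNge (ge_inf Blb)//; split=> //; exists c.
have [c [M [c0 M0 bnd]]] := sigma_bounds.
have postau a' : a' \in E -> 0 < sigma tau a'.
  move=> {a} aE; set a := a' in aE *; have la := hlen aE.
  (* With this [C], [e^{C t} sigma] is nondecreasing: its derivative is
     [e^{C t} sigma (drop p + M) / len], and [p] takes values in [[0, M]]. *)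
  pose C := 1 + M / len a.
  have C0 : 0 <= C by rewrite addr_ge0// divr_ge0// ltW.
  have low r : 0 <= r -> r < tau -> sigma 0 a * expR (- C * r) <= sigma r a.
    move=> r0 rt; have posr u : 0 <= u <= r -> forall a, a \in E -> 0 < sigma u a.
      by move=> /andP[u0 ur]; apply: pos => //; exact: le_lt_trans rt.
    have hm : expR (C * 0) * sigma 0 a <= expR (C * r) * sigma r a.
      apply: (derivative_ge0 (f := fun u => expR (C * u) * sigma u a) (df := fun u =>
         expR (C * u) * (sigma u a * (drop (p u) a / len a - 1)) +
         sigma u a * (C * expR (C * u))) r0) => u ur.
        apply: is_derive_mul; first exact: is_derive_expM.
        by apply: sigma_der => //; case/andP: ur.
      have /andP[u0 u1] := ur.
      have [_ _ hp] := bnd u u0 (fun v hv => posr v (andb_true_intro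
        (conj (proj1 (andP hv)) (le_trans (proj2 (andP hv)) u1)))).
      have -> : expR (C * u) * (sigma u a * (drop (p u) a / len a - 1)) +
         sigma u a * (C * expR (C * u)) =
         expR (C * u) * sigma u a * ((drop (p u) a + M) / len a).
        by rewrite /C; field; rewrite gt_eqF.
      apply: mulr_ge0; first by rewrite mulr_ge0 ?expR_ge0 ?(ltW (posr u ur _ aE)).
      rewrite divr_ge0 ?(ltW la)// /drop.
      by have := hp a.1; have := hp a.2; lra.
    move: hm; rewrite mulr0 expR0 mul1r mulNr expRN mulrC => hm.
    by rewrite mulrC ler_pdivrMl ?expR_gt0 // mulrC.
  move: tau0; rewrite le_eqVlt => /predU1P[<-|tau0]; first exact: sigma0.
  have s0a := sigma0 aE.
  have m0 : 0 < sigma 0 a * expR (- C * tau) by rewrite mulr_gt0 ?expR_gt0.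
  rewrite ltNge; apply/negP => hneg.
  have [delta d0 hd] := continuous_at_eps (sigma_der (ltW tau0) aE) m0.
  pose r := Num.max 0 (tau - delta / 2).
  have r0 : 0 <= r by rewrite le_max lexx.
  have rt : r < tau by rewrite gt_max tau0 /=; lra.
  have rd : tau - delta / 2 <= r by rewrite le_max lexx orbT.
  have := hd r; rewrite ltr_norml => /(_ _) h.
  have : - delta < r - tau < delta by apply/andP; split; lra.
  move=> /h; rewrite ltr_norml => /andP[_ h1].
  have := low r r0 rt; have : sigma 0 a * expR (- C * tau) <= sigma 0 a * expR (- C * r).
    by rewrite ler_pM2l// ler_expR !mulNr lerN2 ler_wpM2l// ltW.
  lra.
have step : exists2 delta, 0 < delta & forall u, `|u - tau| < delta ->
    forall a, a \in E -> 0 < sigma u a.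
  have h (c' : V * V) : exists delta, 0 < delta /\ (c' \in E ->
      forall u, `|u - tau| < delta -> 0 < sigma u c').
    case: (boolP (c' \in E)) => cE; last by exists 1.
    have [d d0 hd] := continuous_at_eps (sigma_der tau0 cE) (postau _ cE).
    exists d; split=> // _ u /hd; rewrite ltr_norml => /andP[h _]; lra.
  have [d hd] := choice h.
  (* The reciprocal of this sum is below every [d c'], so it is a radius valid for all arcs at
     once. *)
  have dS0 : 0 < \sum_c' (d c')^-1 + 1.
    by rewrite ltr_wpDl// sumr_ge0// => c' _; rewrite invr_ge0 ltW//; case: (hd c').
  exists (\sum_c' (d c')^-1 + 1)^-1; first by rewrite invr_gt0.
  move=> u hu c' cE; have [d0 /(_ cE)] := hd c'; apply.
  apply: (lt_le_trans hu); rewrite -[leRHS]invrK lef_pV2 ?posrE ?invr_gt0//.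
  rewrite (bigD1 c')//= -addrA lerDl addr_ge0// sumr_ge0// => i _.
  by rewrite invr_ge0 ltW//; case: (hd i).
have [delta d0 hd] := step.
(* Some bad time lies within [delta] of [tau], where all conductivities are positive. *)
have [u Bu ut] := inf_adherent d0 (conj Bn0 Blb).
have tu : tau <= u by exact: ge_inf.
case: Bu => u0 [c' cE]; apply/negP; rewrite -ltNge; apply: hd => //.
by rewrite ger0_norm ?subr_ge0// ltrBlDl.
Qed.

End Lyapunov.
End Dynamics.

(** * The time integral of the potential *)

Section IntegratedPotential.
Variables (R : realType) (V : finType) (E : {set V * V}) (len : V * V -> R).
Variables (sigma : R -> V * V -> R) (p : R -> V -> R) (root : V).
Hypothesis hG : connected_digraph E.
Hypothesis sigma_der : forall (t : R) a, 0 <= t -> a \in E ->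
  is_derive t (1 : R) (sigma^~ a) (sigma t a * (drop (p t) a / len a - 1)).
Hypothesis hlen : forall a, a \in E -> 0 < len a.
Hypothesis sigma_pos : forall (t : R) a, 0 <= t -> a \in E -> 0 < sigma t a.

(* len * ln sigma + len * t has derivative drop p, so it is, up to a constant,
   the drop of a vertex function P, the time integral of p - p root. *)
Lemma integrated_potential : exists P : R -> V -> R,
  forall t : R, 0 <= t -> P t root = 0 /\ forall a, a \in E ->
    drop (P t) a = len a * (ln (sigma t a) - ln (sigma 0 a) + t).
Proof.
have [_ _ conn] := hG.
have [chi hchi] := connected_chains R conn (finset.in_setT root).
pose L t a := len a * (ln (sigma t a) - ln (sigma 0 a) + t).
(* [P] sums [L] along a chain from [i] to the root. Its drop is [L] on every arc, as both vanish at
   time [0] and have derivative [drop p]. *)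
pose P t i := \sum_(a in E) chi i a * L t a.
have L_der (t : R) a : 0 <= t -> a \in E -> is_derive t (1 : R) (L^~ a) (drop (p t) a).
  move=> t0 aE; have sa := sigma_pos t0 aE; have la := hlen aE.
  have -> : drop (p t) a = len a *
     (sigma t a * (drop (p t) a / len a - 1) / sigma t a + - 0 + 1).
    by field; rewrite !gt_eqF.
  apply: is_derive_cstM; apply: is_derive_add; apply: is_derive_add.
  by apply: is_derive_lnf => //; exact: sigma_der.
have P_der (t : R) i : 0 <= t -> is_derive t (1 : R) (P^~ i) (p t i - p t root).
  move=> t0; rewrite hchi ?finset.in_setT//.
  by apply: is_derive_bigsum => a aE; apply: is_derive_cstM; exact: L_der.
have key (t : R) a : 0 <= t -> a \in E -> drop (P t) a = L t a.
  move=> t0 aE; pose g s := P s a.1 - P s a.2 - L s a.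
  have : g t = g 0.
    apply: (derivative_eq0 t0) => s /andP[s0 _].
    have -> : 0 = (p s a.1 - p s root) - (p s a.2 - p s root) - drop (p s) a.
      by rewrite /drop; ring.
    by apply: is_deriveB; [apply: is_deriveB; exact: P_der|exact: L_der].
  have L0 c : L 0 c = 0 by rewrite /L subrr add0r mulr0.
  have P0 i : P 0 i = 0 by rewrite /P big1// => c _; rewrite L0 mulr0.
  by rewrite /g !P0 L0 !subr0 => /subr0_eq.
exists P => t t0; split=> [|a aE]; last exact: key.
(* Since [L] is the drop of [P], its sum along the closed chain at the root is zero. *)
have := hchi root (finset.in_setT _) (P t); rewrite subrr => h; rewrite {1}h.
by apply: eq_bigr => a aE; rewrite key.
Qed.
End IntegratedPotential.

(** * Rescaled conductivities outside a subgraph *)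

Section Stage.
Variables (R : realType) (V : finType) (E H : {set V * V}).
Variables (len : V * V -> R) (b : V -> R).
Variables (sigma : R -> V * V -> R) (p P : R -> V -> R).
Hypothesis hE : loopless E.
Hypothesis hlen : forall a, a \in E -> 0 < len a.
Hypothesis sigma_der : forall (t : R) a, 0 <= t -> a \in E ->
  is_derive t (1 : R) (sigma^~ a) (sigma t a * (drop (p t) a / len a - 1)).
Hypothesis sigma_pos : forall (t : R) a, 0 <= t -> a \in E -> 0 < sigma t a.
Hypothesis kirchhoff : forall (t : R) i, 0 <= t ->
  divergence E (current len (sigma t) (p t)) i = b i.
Hypothesis P_drop : forall t : R, 0 <= t -> forall a, a \in E ->
  drop (P t) a = len a * (ln (sigma t a) - ln (sigma 0 a) + t).
Hypothesis balanced : forall i, i \notin verts H -> b i = 0.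
Variables (r : R) (y : V -> R).
Hypothesis r0 : 0 < r.
Local Notation F := (E :\: H).
Hypothesis y_slack : forall a, a \in F -> drop y a <= r * len a.

(* On an arc where p has slope r, sigma is of order e^{-(1 - r) t}, and rho is
   of order 1. *)
Let rho t a := expR ((1 - r) * t) * sigma t a.
Let slack a := r * len a - drop y a.
Let q t i := P t i - y i * t.
Local Notation n := (#|V|%:R : R).

Let FE a : a \in F -> a \in E. Proof. by case/setDP. Qed.
Let hF : loopless F. Proof. by move=> i; apply: contra (hE i); exact: FE. Qed.

Lemma rho_gt0 (t : R) a : 0 <= t -> a \in F -> 0 < rho t a.
Proof. by move=> t0 /FE aE; rewrite mulr_gt0 ?expR_gt0 ?sigma_pos. Qed.

Lemma rhoE (t : R) a : 0 <= t -> a \in F ->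
  rho t a = sigma 0 a * expR ((drop (q t) a - slack a * t) / len a).
Proof.
move=> t0 /FE aE; have la := hlen aE; have sa := sigma_pos t0 aE.
rewrite -[X in X * expR (_ / _)]lnK ?posrE ?sigma_pos//.
rewrite /rho -[X in _ * X]lnK ?posrE// -!expRD; congr expR.
have -> : drop (q t) a = drop (P t) a - drop y a * t by rewrite /q /drop; ring.
by rewrite P_drop// /slack; field; rewrite gt_eqF.
Qed.

(** The imbalance of [sigma] decays like [e^{-t}]; rescaling by [e^{(1 - r) t}] leaves
    [e^{-r t}]. *)
Lemma divergence_rho (t : R) i : 0 <= t -> i \notin verts H ->
  divergence F (rho t) i = imbalance E b sigma i * expR (- r * t).
Proof.
move=> t0 iH; rewrite divergence_setD//.
have -> : divergence E (rho t) i = expR ((1 - r) * t) * divergence E (sigma t) i.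
  by rewrite /divergence mulr_sumr; apply: eq_bigr => a _; rewrite /rho; ring.
rewrite (divergence_sigma sigma_der kirchhoff)// balanced// add0r mulrA -expRD mulrC.
by congr (_ * expR _); ring.
Qed.

Lemma divergence_rho_current (t : R) i : 0 <= t -> i \notin verts H ->
  divergence F (fun a => rho t a * drop (p t) a / len a) i = 0.
Proof.
move=> t0 iH; rewrite divergence_setD//.
have -> : divergence E (fun a => rho t a * drop (p t) a / len a) i =
    expR ((1 - r) * t) * divergence E (current len (sigma t) (p t)) i.
  rewrite /divergence mulr_sumr; apply: eq_bigr => a _.
  by rewrite /rho /current /drop; ring.
by rewrite kirchhoff// balanced// mulr0.
Qed.

Hypothesis q_bounded : forall i, i \in verts H -> bounded_on_ray (q^~ i).

(** If [q] drops along [e] by little compared with [slack e * t], then [rhoE] gives the bound.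
    Otherwise [potential_cut] applies with a gap growing linearly in [t], and arcs running up such a
    gap carry exponentially little [rho]. On a tight arc all this degenerates to boundedness. *)
Lemma rho_majorant e : e \in F -> exists A delta : R,
  [/\ 0 <= A, 0 <= delta, 0 < slack e -> 0 < delta &
    forall t, 0 <= t -> rho t e <= A * expR (- delta * t)].
Proof.
move=> eF; have le := hlen (FE eF); have s0 : 0 <= slack e by rewrite subr_ge0 y_slack.
have [C C0 hC] := bounded_all q_bounded.
have n0 : 0 <= n by rewrite ler0n.
pose I0 := \sum_i `|imbalance E b sigma i|.
have I00 : 0 <= I0 by rewrite sumr_ge0.
pose S0 := \sum_(a in E) sigma 0 a.
have sig0 a : a \in E -> 0 <= sigma 0 a by move=> aE; rewrite ltW ?sigma_pos.
have S00 : 0 <= S0 by rewrite sumr_ge0.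
have sigS a : a \in E -> sigma 0 a <= S0.
  by move=> aE; rewrite /S0 (bigD1 a)//= lerDl sumr_ge0// => i /andP[/sig0].
pose Lam := \sum_(a in E) len a.
have lenL a : a \in E -> len a <= Lam.
  move=> aE; rewrite /Lam (bigD1 a)//= lerDl sumr_ge0// => i /andP[/hlen/ltW]//.
have Lam0 : 0 < Lam by apply: lt_le_trans (lenL e (FE eF)).
(* Chosen so that the threshold [2 (n + 1) (1 + kap t)] uses up half of [slack e * t]; the other
   half remains for the decay when the drop is below it. *)
pose kap := slack e / (4 * (n + 1)).
have kap0 : 0 <= kap by rewrite divr_ge0// mulr_ge0// addr_ge0.
(* [A1] and [A2] come from the two terms of the cut bound, imbalance and inflow, and [A3] from the
   case of a small drop. Their rates are [r], [d2] and [d3]. *)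
pose A1 := n * I0; pose A2 := #|F|%:R * S0.
pose A3 := S0 * expR ((2 * C + 2 * (n + 1)) / len e).
have A10 : 0 <= A1 by rewrite mulr_ge0.
have A20 : 0 <= A2 by rewrite mulr_ge0.
have A30 : 0 <= A3 by rewrite mulr_ge0// expR_ge0.
pose d2 := kap / Lam; pose d3 := slack e / (2 * len e).
pose delta := Num.min r (Num.min d2 d3).
have d20 : 0 <= d2 by rewrite divr_ge0// ltW.
have d30 : 0 <= d3 by rewrite divr_ge0// mulr_ge0// ltW.
exists (A1 + A2 + A3), delta; split=> [|||t t0].
- by rewrite !addr_ge0.
- by rewrite !le_min (ltW r0) d20 d30.
- move=> sp; rewrite !lt_min r0 /= !divr_gt0 ?mulr_gt0//.
  by rewrite ltr_wpDl.
have mono A d : 0 <= A -> delta <= d -> A * expR (- d * t) <= A * expR (- delta * t).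
  by move=> A0 dd; rewrite ler_wpM2l// ler_expR ler_wpM2r// lerN2.
have m1 := mono A1 r A10; have m2 := mono A2 d2 A20; have m3 := mono A3 d3 A30.
have {}m1 : A1 * expR (- r * t) <= A1 * expR (- delta * t).
  by apply: m1; rewrite ge_min lexx.
have {}m2 : A2 * expR (- d2 * t) <= A2 * expR (- delta * t).
  by apply: m2; rewrite !ge_min lexx orbT.
have {}m3 : A3 * expR (- d3 * t) <= A3 * expR (- delta * t).
  by apply: m3; rewrite !ge_min lexx !orbT.
rewrite !mulrDl.
have e0 (x : R) : 0 <= expR x by exact: expR_ge0.
have [hbig|hsmall] :=
    leP (2 * C + 2 * (n + 1) * (1 + kap * t)) (drop (q t) e).
  have g0 : 0 < 1 + kap * t by rewrite ltr_pwDl// mulr_ge0.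
  have := @potential_cut R V F (verts H) (rho t) (q t) C (I0 * expR (- r * t))
    (S0 * expR (- d2 * t)) (1 + kap * t) e hF _ _ _ C0 _ _ g0 _ eF hbig.
  have h1 : 0 <= A3 * expR (- delta * t) by rewrite mulr_ge0.
  move=> h; apply: (le_trans (h _ _ _ _ _ _)).
  - by move=> a aF; rewrite ltW// rho_gt0.
  - move=> i iH; rewrite divergence_rho// normrM (ger0_norm (e0 _)) ler_wpM2r//.
    by rewrite /I0 (bigD1 i)//= lerDl sumr_ge0.
  - by move=> i iH; apply: hC.
  - exact: mulr_ge0.
  - exact: mulr_ge0.
  (* Where [q] rises by [1 + kap t], [rhoE] gives decay at rate [kap / len a], and [len a <= Lam]
     makes the rate uniform. *)
  - move=> a aF hd; rewrite rhoE//; apply: ler_pM => //; rewrite ?sig0 ?sigS ?FE//.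
    rewrite ler_expR ler_pdivrMr ?hlen ?FE//.
    have sa : 0 <= slack a * t by rewrite mulr_ge0// subr_ge0 y_slack.
    have dl : kap / Lam * t * len a <= kap * t.
      have -> : kap / Lam * t * len a = kap * t * (len a / Lam).
        by field; rewrite gt_eqF.
      apply: ler_piMr; first exact: mulr_ge0.
      by rewrite ler_pdivrMr// mul1r lenL// FE.
    rewrite /d2 mulNr mulNr; lra.
  rewrite !mulrA -/A1 -/A2; lra.
have h1 : 0 <= A1 * expR (- delta * t) by rewrite mulr_ge0.
have h2 : 0 <= A2 * expR (- delta * t) by rewrite mulr_ge0.
suff : rho t e <= A3 * expR (- d3 * t) by lra.
rewrite rhoE// /A3 -mulrA -expRD; apply: ler_pM => //; rewrite ?sig0 ?sigS ?FE//.
rewrite ler_expR ler_pdivrMr//.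
have -> : ((2 * C + 2 * (n + 1)) / len e + - d3 * t) * len e =
   2 * C + 2 * (n + 1) - slack e * t / 2.
  by rewrite /d3; field; rewrite gt_eqF.
have hk : 2 * (n + 1) * (1 + kap * t) = 2 * (n + 1) + slack e * t / 2.
  by rewrite /kap; field; rewrite gt_eqF// ltr_wpDl.
by move: hsmall; rewrite hk; lra.
Qed.

Lemma rho_bounded a : a \in F -> bounded_on_ray (rho^~ a).
Proof.
move=> aF; have [A [d [A0 d0 _ h]]] := rho_majorant aF.
exists A => t t0; rewrite ger0_norm ?(ltW (rho_gt0 t0 aF))//.
apply: (le_trans (h t t0)); rewrite ler_piMr// -[leRHS]expR0 ler_expR mulNr oppr_le0.
exact: mulr_ge0.
Qed.

(** The factor [slack a] covers tight arcs too, where [rho] is only bounded. *)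
Lemma slack_rho_decay a : a \in F -> exp_decay (fun t => slack a * rho t a).
Proof.
move=> aF; have := y_slack aF; rewrite -subr_ge0 -/(slack a) le_eqVlt.
case/predU1P=> [<-|s0]; first by under eq_fun do rewrite mul0r; exact: exp_decay0.
have [A [d [A0 d0 /(_ s0) dp h]]] := rho_majorant aF.
exists d, (slack a * A); split=> // t t0.
have rp := ltW (rho_gt0 t0 aF).
rewrite ger0_norm; last exact: mulr_ge0 (ltW s0) rp.
by rewrite -mulrA ler_wpM2l ?h// ltW.
Qed.
End Stage.

(** * Weighted energy of the deviation from the extended potential *)

Section Energy.
Variables (R : realType) (V : finType) (F : {set V * V}) (len : V * V -> R).
Variables (rho : R -> V * V -> R) (p : R -> V -> R) (y : V -> R) (r : R).
Hypothesis hF : loopless F.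
Hypothesis hlen : forall a, a \in F -> 0 < len a.
Hypothesis rho_ge0 : forall (t : R) a, 0 <= t -> a \in F -> 0 <= rho t a.
Hypothesis p_bounded : forall i, bounded_on_ray (p^~ i).
Let u t i := p t i - y i.

Lemma u_bounded i : bounded_on_ray (u^~ i).
Proof. by apply: bounded_sub => //; exact: bounded_cst. Qed.

(* The weighted energy of u = p - y is the sum of u * div(rho (x - r)), with
   x = drop p / len, and of rho * (r len - drop y) * drop u / len. *)
Lemma energy_decay :
  (forall i, exp_decay (fun t => u t i *
    (divergence F (fun a => rho t a * drop (p t) a / len a) i -
     r * divergence F (rho t) i))) ->
  (forall a, a \in F -> exp_decay (fun t => (r * len a - drop y a) * rho t a)) ->
  forall a, a \in F -> exp_decay (fun t => rho t a * drop (u t) a ^+ 2).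
Proof.
move=> h1 h2 a aF; pose en t := \sum_(c in F) rho t c * drop (u t) c ^+ 2 / len c.
have enE t : en t = \sum_i u t i *
    (divergence F (fun a => rho t a * drop (p t) a / len a) i -
     r * divergence F (rho t) i) +
    \sum_(c in F) (r * len c - drop y c) * rho t c * (drop (u t) c / len c).
  have -> : forall A B : V -> R,
      \sum_i u t i * (A i - r * B i) = \sum_i u t i * A i - r * \sum_i u t i * B i.
    move=> A B; rewrite mulr_sumr -sumrB; apply: eq_bigr => i _; ring.
  rewrite !sum_divergence// mulr_sumr -sumrB -big_split /=.
  apply: eq_bigr => c /hlen lc; rewrite /u dropB.
  by field; rewrite gt_eqF.
have hen : exp_decay en.
  rewrite (funext enE).
  apply: exp_decay_add; first by apply: exp_decay_sum => i _; exact: h1.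
  apply: exp_decay_sum => c cF.
  apply: exp_decay_mul; first exact: h2.
  apply: bounded_mul; last exact: bounded_cst.
  by apply: bounded_sub; exact: u_bounded.
apply: exp_decay_le (exp_decay_mul hen (bounded_cst (len a))) _ => t t0.
have nn c : c \in F -> 0 <= rho t c * drop (u t) c ^+ 2 / len c.
  by move=> cF; rewrite divr_ge0 ?(ltW (hlen cF))// mulr_ge0 ?sqr_ge0 ?rho_ge0.
have en0 : 0 <= en t by apply: sumr_ge0 => c; exact: nn.
have ra0 : 0 <= rho t a * drop (u t) a ^+ 2 by rewrite mulr_ge0 ?sqr_ge0 ?rho_ge0.
rewrite (ger0_norm ra0) (ger0_norm (mulr_ge0 en0 (ltW (hlen aF)))).
rewrite -ler_pdivrMr ?hlen// /en (bigD1 a)//= lerDl sumr_ge0// => c /andP[cF _].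
exact: nn.
Qed.

Lemma drop_decay a (c : R) : exp_decay (fun t => rho t a * drop (u t) a ^+ 2) ->
  0 < c -> (forall t : R, 0 <= t -> c <= rho t a) ->
  exp_decay (fun t => drop (u t) a).
Proof.
move=> h c0 hc; apply: exp_decay_sqr.
apply: exp_decay_le (exp_decay_mul h (bounded_cst c^-1)) _ => t t0.
have ra := hc t t0; have ra0 : 0 <= rho t a by apply: le_trans ra; exact: ltW.
have l0 : 0 <= rho t a * drop (u t) a ^+ 2 by rewrite mulr_ge0 ?sqr_ge0.
have c0' : 0 <= c^-1 by rewrite invr_ge0 ltW.
rewrite (ger0_norm (sqr_ge0 _)) (ger0_norm (mulr_ge0 l0 c0')).
rewrite mulrAC -[leLHS]mul1r ler_wpM2r ?sqr_ge0//.
by rewrite ler_pdivlMr// mul1r.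
Qed.
End Energy.

(** * Convergence along the extension *)

Section PathBounds.
Variables (R : realType) (V : finType).

(** Summing the drops from [x] to [i] bounds [d i] below, and summing them from [i] to the end
    bounds it above: upper bounds on drops become two-sided bounds between the end values. *)
Lemma path_drop_bound (d : V -> R) (C : R) x w : 0 <= C ->
  (forall a, a \in path_arcs (x :: w) -> drop d a <= C) ->
  forall i, i \in x :: w ->
    d x - (size w)%:R * C <= d i <= d (last x w) + (size w)%:R * C.
Proof.
move=> C0; elim: w x => [|z w IH] x hd i.
  by rewrite inE => /eqP->; rewrite mul0r subr0 addr0 lexx.
have xz : drop d (x, z) <= C by apply: hd; rewrite path_arcs_cons mem_head.
have {}IH := IH z (fun a az => hd a (mem_behead (s := path_arcs (x :: z :: w)) az)).
have wC : 0 <= (size w)%:R * C by rewrite mulr_ge0.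
move: xz; rewrite /drop /= => xz.
rewrite -natr1 mulrDl mul1r inE => /orP[/eqP->|/IH/andP[]]; last first.
  by move=> h1 h2; apply/andP; split; lra.
by have /andP[_ h] := IH z (mem_head _ _); apply/andP; split; lra.
Qed.

Lemma path_exp_decay (u : R -> V -> R) x w : exp_decay (u^~ x) ->
  (forall a, a \in path_arcs (x :: w) -> exp_decay (fun t => drop (u t) a)) ->
  forall i, i \in x :: w -> exp_decay (u^~ i).
Proof.
elim: w x => [|z w IH] x hx hd i; first by rewrite inE => /eqP->.
rewrite inE => /orP[/eqP->//|]; apply: IH => [|a az].
  have := exp_decay_sub hx (hd (x, z) (mem_head _ _)).
  by move/exp_decay_le; apply=> t _; rewrite /drop subKr.
by apply: hd; rewrite path_arcs_cons inE az orbT.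
Qed.

(** A single arc is outside [H] because the path is not contained in [H]; on a longer path every arc
    has an internal vertex as an endpoint. *)
Lemma trajectory_arcs (E H : {set V * V}) x s y : trajectory E H x s y ->
  forall a, a \in path_arcs (x :: rcons s y) -> a \in E :\: H.
Proof.
case/and5P=> /andP[_ /allP hE] hH xH yH /allP hs a aw.
have aE : a \in E := hE a aw; rewrite inE aE andbT {hE aE}.
case: s => [|z s] in hH hs aw *.
  by move: aw hH; rewrite /path_arcs /= inE => /eqP->; rewrite andbT.
apply/negP => aH; have /andP[] := mem_path_arcs aw.
rewrite rcons_cons /= belast_rcons inE => /orP[/eqP ax _|a1 _]; last first.
  by have := hs _ a1; rewrite verts_l.
have := aw; rewrite rcons_cons path_arcs_cons inE => /orP[/eqP az|].
  by have := hs z (mem_head _ _); rewrite (_ : z = a.2) ?verts_r// az.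
case/mem_path_arcs/andP; rewrite belast_rcons => a1 _.
by have := hs _ a1; rewrite verts_l.
Qed.

Lemma bounded_divergence (F : {set V * V}) (g : R -> V * V -> R) i :
  (forall a, a \in F -> bounded_on_ray (g^~ a)) ->
  bounded_on_ray (fun t => divergence F (g t) i).
Proof.
move=> h; apply: bounded_sum => a aF; apply: bounded_mul; last exact: h.
exact: bounded_cst.
Qed.
End PathBounds.

(** * Convergence on the optimal set and along one extension step *)

Section Convergence.
Variables (R : realType) (V : finType) (E : {set V * V}).
Variables (len : V * V -> R) (b : V -> R) (f : V * V -> R).
Local Notation Hhat := (optimal_set E len b).
Hypothesis hG : connected_digraph E.
Hypothesis hlen : forall a, a \in E -> 0 < len a.
Hypothesis f_opt : optimal_flow E len b f.
Hypothesis f_supp : forall a, a \in E -> if a \in Hhat then 0 < f a else f a == 0.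
Hypothesis conn : connected_on (verts Hhat) Hhat.
Variables (phat : V -> R) (root : V).
Hypothesis phat_opt : optimal_potential Hhat len phat.
Hypothesis root_in : root \in verts Hhat.
Hypothesis phat_root : phat root = 0.

Variables (sigma : R -> V * V -> R) (p : R -> V -> R).
Hypothesis sigma0 : forall a, a \in E -> 0 < sigma 0 a.
Hypothesis sigma_der : forall (t : R) a, 0 <= t -> a \in E ->
  is_derive t (1 : R) (sigma^~ a) (sigma t a * (drop (p t) a / len a - 1)).
Hypothesis kirchhoff : forall (t : R) i, 0 <= t ->
  divergence E (current len (sigma t) (p t)) i = b i.
Hypothesis p_min : forall t : R, 0 <= t -> min_zero_on [set: V] (p t).

Let hE : loopless E. Proof. by case: hG. Qed.
Let HE a : a \in Hhat -> a \in E.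
Proof. exact/fintype.subsetP/optimal_set_sub. Qed.

(** Extension of [phat] with slope bound [1], which [optimal_path_le] provides: a dual optimal
    solution. *)
Lemma optimal_dual : exists y : V -> R,
  [/\ forall i, i \in verts Hhat -> y i = phat i,
      forall a, a \in E -> drop y a <= len a &
      forall a, a \in Hhat -> drop y a = len a].
Proof.
have [x s z|y y1 y2] :=
    potential_extension (H := Hhat) (p := phat) hlen (@ler01 R).
  case/and5P=> /andP[_ hw] _ xH zH _; rewrite mul1r.
  have := optimal_path_le hE f_opt f_supp conn phat_opt hw xH.
  by rewrite last_rcons; apply.
have yH a : a \in Hhat -> drop y a = len a.
  move=> aH; rewrite /drop !y1 ?verts_l ?verts_r//.
  by case: phat_opt => /(_ a aH).
exists y; split=> // a aE; case: (boolP (a \in Hhat)) => aH; first by rewrite yH.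
by rewrite -[leRHS]mul1r y2// inE aH.
Qed.

Lemma sigma_pos (t : R) a : 0 <= t -> a \in E -> 0 < sigma t a.
Proof.
have [y [_ y1 y2]] := optimal_dual.
exact: (sigma_gt0 hG hlen f_opt f_supp conn root_in sigma0 sigma_der kirchhoff
  p_min y1 y2).
Qed.

Lemma sigma_p_bounds : exists c M : R, [/\ 0 < c, 0 <= M &
  forall t : R, 0 <= t ->
  [/\ forall a, a \in E -> sigma t a <= M, forall a, a \in Hhat -> c <= sigma t a &
      forall i, 0 <= p t i <= M]].
Proof.
have [y [_ y1 y2]] := optimal_dual.
have [c [M [c0 M0 h]]] :=
  sigma_bounds hG hlen f_opt f_supp conn root_in sigma_der kirchhoff p_min y1 y2.
exists c, M; split=> // t t0; apply: h => // s /andP[s0 _] a; exact: sigma_pos.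
Qed.

Lemma p_bounded i : bounded_on_ray (p^~ i).
Proof.
have [c [M [_ _ h]]] := sigma_p_bounds.
by exists M => t /h[_ _ /(_ i)/andP[p0 pM]]; rewrite ger0_norm.
Qed.

Variable P : R -> V -> R.
Hypothesis P_spec : forall t : R, 0 <= t -> P t root = 0 /\ forall a, a \in E ->
    drop (P t) a = len a * (ln (sigma t a) - ln (sigma 0 a) + t).

Let P_drop (t : R) : 0 <= t -> forall a, a \in E ->
  drop (P t) a = len a * (ln (sigma t a) - ln (sigma 0 a) + t).
Proof. by case/P_spec. Qed.

(** The invariant of the induction along the extension. The first clause makes [b] vanish off [H],
    and the second is the boundary condition for the estimates on [rho] at the next step. *)
Definition converges_on (H : {set V * V}) (p0 : V -> R) : Prop :=
  [/\ {subset verts Hhat <= verts H},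
      forall i, i \in verts H -> bounded_on_ray (fun t => P t i - p0 i * t) &
      forall i, i \in verts H -> exp_decay (fun t => p t i - p0 i)].

Lemma sigma_log_bounded a : a \in Hhat -> bounded_on_ray (fun t => ln (sigma t a)).
Proof.
have [c [M [c0 M0 h]]] := sigma_p_bounds => aH.
exists (`|ln c| + `|ln M|) => t t0; have [sM sc _] := h t t0.
have {}sM := sM a (HE aH); have {}sc := sc a aH.
have s0 := lt_le_trans c0 sc; have M0' := lt_le_trans s0 sM.
have h1 : ln c <= ln (sigma t a) by rewrite ler_ln ?posrE.
have h2 : ln (sigma t a) <= ln M by rewrite ler_ln ?posrE.
have h3 := ler_norm (ln M); have h4 : - `|ln c| <= ln c by rewrite lerNl -normrN ler_norm.
have := normr_ge0 (ln c); have := normr_ge0 (ln M).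
by rewrite ler_norml => *; apply/andP; split; lra.
Qed.

(** On the optimal set [drop phat = len], so the drop of [P - phat t] involves only [ln sigma],
    which is bounded there; a chain to the root sums these drops. *)
Lemma optimal_integrated_bounded i : i \in verts Hhat ->
  bounded_on_ray (fun t => P t i - phat i * t).
Proof.
have [chi hchi] := connected_chains R conn root_in => iH.
have : bounded_on_ray (fun t => \sum_(a in Hhat) chi i a *
    (len a * (ln (sigma t a) - ln (sigma 0 a)))).
  apply: bounded_sum => a aH; apply: bounded_mul; first exact: bounded_cst.
  apply: bounded_mul; first exact: bounded_cst.
  by apply: bounded_sub; [exact: sigma_log_bounded|exact: bounded_cst].
move=> /bounded_le; apply=> t t0; rewrite le_eqVlt; apply/orP; left; apply/eqP.
congr (`| _ |); have [Pr _] := P_spec t0.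
have := hchi i iH (fun j => P t j - phat j * t).
rewrite Pr phat_root mul0r !subr0 => ->; apply: eq_bigr => a aH; congr (_ * _).
have -> : drop (fun j => P t j - phat j * t) a = drop (P t) a - drop phat a * t.
  by rewrite /drop; ring.
have -> : drop phat a = len a by case: phat_opt => /(_ a aH).
rewrite P_drop ?HE//; ring.
Qed.

(** The energy on all of [E], with [r = 1], decays because [B sigma - b] does. This gives
    convergence of the drops along the optimal set, hence of [p] up to a constant, which the
    normalisation fixes. *)
Lemma converges_on_optimal : converges_on Hhat phat.
Proof.
split=> //; first exact: optimal_integrated_bounded.
have [y [yphat y1 y2]] := optimal_dual.
have [c [M [c0 M0 bnd]]] := sigma_p_bounds.
have bal i : i \notin verts Hhat -> b i = 0 by apply: optimal_balanced f_opt f_supp i.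
have hu i : bounded_on_ray (fun t => p t i - y i).
  by apply: bounded_sub; [exact: p_bounded|exact: bounded_cst].
have en a : a \in E ->
    exp_decay (fun t => sigma t a * drop (fun i => p t i - y i) a ^+ 2).
  apply: (energy_decay (r := 1) hE hlen) => [t c' t0 cE|i|i|c' cE].
  - by rewrite ltW ?sigma_pos.
  - exact: p_bounded.
  - have := exp_decay_mul (exp_decay_exp (- imbalance E b sigma i) (@ltr01 R)) (hu i).
    move/exp_decay_le; apply=> t t0.
    rewrite (_ : divergence E _ i = b i); last exact: kirchhoff.
    rewrite (divergence_sigma sigma_der kirchhoff)//.
    rewrite (_ : - imbalance E b sigma i * _ * _ = (p t i - y i) *
      (b i - 1 * (b i + expR (- t) * imbalance E b sigma i)))//.
    by rewrite mulN1r; ring.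
  case: (boolP (c' \in Hhat)) => cH.
    by under eq_fun do rewrite y2// mul1r subrr mul0r; exact: exp_decay0.
  have cF : c' \in E :\: Hhat by rewrite inE cH.
  have ysl a' : a' \in E :\: Hhat -> drop y a' <= 1 * len a'.
    by case/setDP=> aE _; rewrite mul1r y1.
  have qb i : i \in verts Hhat -> bounded_on_ray (fun t => P t i - y i * t).
    by move=> iH; rewrite yphat//; exact: optimal_integrated_bounded.
  (* For [r = 1] the weight [rho] is [sigma] itself. *)
  have := slack_rho_decay hE hlen sigma_der sigma_pos kirchhoff P_drop bal ltr01
    ysl qb cF.
  by under eq_fun do rewrite subrr mul0r expR0 mul1r.
have du a : a \in Hhat -> exp_decay (fun t => drop (fun i => p t i - y i) a).
  move=> aH; apply: (drop_decay (en a (HE aH)) c0) => t /bnd[_ sc _]; exact: sc.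
have [chi hchi] := connected_chains R conn root_in.
have rel i : i \in verts Hhat ->
    exp_decay (fun t => (p t i - y i) - (p t root - y root)).
  move=> iH; under eq_fun do rewrite (hchi i iH (fun j => _ - _)).
  apply: exp_decay_sum => a aH; under eq_fun do rewrite mulrC.
  by apply: exp_decay_mul; [exact: du|exact: bounded_cst].
(* At a zero [k] of [p t] in the optimal set, the deviation relative to the root is
   [- (y k + p t root)] with both terms nonnegative, so it controls [p t root]. As [k] varies with
   [t], the deviations are summed over all vertices. *)
have hroot : exp_decay (fun t => p t root - y root).
  have : exp_decay (fun t => \sum_(i in verts Hhat)
     `|(p t i - y i) - (p t root - y root)|).
    apply: exp_decay_sum => i /rel; move/exp_decay_le; apply=> t _.
    by rewrite normr_id.
  move/exp_decay_le; apply=> t t0; have p0 := p_min t0.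
  have [k kH pk] := potential_zero hG hlen f_opt f_supp (fun a => sigma_pos t0)
    (fun i => kirchhoff i t0) root_in p0.
  have pr : 0 <= p t root by case: p0 => + _; apply; rewrite finset.in_setT.
  have yk : 0 <= y k by rewrite yphat//; case: phat_opt => _ [+ _]; exact.
  have yr : y root = 0 by rewrite yphat.
  rewrite [leRHS]ger0_norm ?sumr_ge0// yr subr0 ger0_norm// (bigD1 k)//=.
  rewrite pk; set S := \sum_(_ in _ | _) _.
  have S0 : 0 <= S by exact: sumr_ge0.
  have -> : 0 - y k - p t root = - (y k + p t root) by ring.
  by rewrite normrN ger0_norm ?addr_ge0//; lra.
move=> i iH; have := exp_decay_add (rel i iH) hroot.
by move/exp_decay_le; apply=> t _; rewrite subrK yphat.
Qed.

(** The upper bound on [rho] bounds the drops of [q] above along the path; as [q] is bounded at both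
    ends, it is bounded on the whole path, and so [rho] is bounded below there. The energy estimate
    then gives decay from arc to arc, starting at [x]. *)
Lemma converges_on_step (leV : rel V) H p0 x s z p' :
  converges_on H p0 -> selected E len leV H p0 x s z ->
  (forall i, i \in verts H -> p' i = p0 i) ->
  (forall a, a \in path_arcs (x :: rcons s z) ->
     drop p' a = slope len p0 x s z * len a) ->
  converges_on (H :|: [set a in path_arcs (x :: rcons s z)]) p'.
Proof.
move=> [HhatH hP hp] [htraj]; set r := slope len p0 x s z => r0 hmax p'H p'pi.
set pi := path_arcs (x :: rcons s z) in p'pi *.
have len_traj x' s' z' : trajectory E H x' s' z' ->
    0 < \sum_(a <- path_arcs (x' :: rcons s' z')) len a.
  move=> h; have hF := trajectory_arcs h.
  have [a aw] : exists a, a \in path_arcs (x' :: rcons s' z').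
    by case: (s') => [|k s'']; eexists; apply: mem_head.
  rewrite (big_rem a)//= ltr_pwDl ?hlen//; first by have /setDP[] := hF a aw.
  rewrite big_seq sumr_ge0// => c /mem_rem/hF/setDP[/hlen/ltW]//.
have hslope x' s' z' : trajectory E H x' s' z' ->
    p0 x' - p0 z' <= r * \sum_(a <- path_arcs (x' :: rcons s' z')) len a.
  move=> h; have [+ _] := hmax x' s' z' h.
  by rewrite /slope ler_pdivrMr ?len_traj.
have [y y1 y2] := potential_extension hlen (ltW r0) hslope.
have piF := trajectory_arcs htraj; rewrite -/pi in piF.
have [/andP[_ _] _ xH zH _] := and5P htraj.
have bal i : i \notin verts H -> b i = 0.
  by move=> iH; apply: (optimal_balanced f_opt f_supp); apply: contra iH; exact: HhatH.
(* The slacks along the path are nonnegative, and their sum vanishes since the path has slope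
   exactly [r]. *)
have tight a : a \in pi -> drop y a = r * len a.
  move=> api; have : \sum_(c <- pi) (r * len c - drop y c) = 0.
    rewrite sumrB path_arcs_sum_drop last_rcons !y1// -mulr_sumr.
    by rewrite /r /slope -/pi divfK ?subrr// gt_eqF// len_traj.
  rewrite big_seq => /eqP; rewrite psumr_eq0; last first.
    by move=> c /piF cF; rewrite subr_ge0 y2.
  by move=> /allP/(_ a api); rewrite api subr_eq0 => /eqP.
(* [p' - y] has zero drop along the path and vanishes at its ends. *)
have p'y i : i \in x :: rcons s z -> p' i = y i.
  move=> iw; have hd a : a \in pi -> drop (fun j => p' j - y j) a <= 0.
    by move=> api; rewrite dropB p'pi// tight// subrr.
  have := path_drop_bound (lexx 0) hd iw.
  rewrite last_rcons !mulr0 subr0 addr0 (p'H _ xH) (p'H _ zH) (y1 _ xH) (y1 _ zH).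
  rewrite !subrr => h.
  by apply/eqP; rewrite -subr_eq0 eq_le andbC.
pose rho t a := expR ((1 - r) * t) * sigma t a.
pose q t i := P t i - y i * t.
have q_bounded i : i \in verts H -> bounded_on_ray (q^~ i).
  by move=> iH; rewrite /q y1//; exact: hP.
have rho_bnd a : a \in E :\: H -> bounded_on_ray (rho^~ a).
  exact: (rho_bounded hE hlen sigma_der sigma_pos kirchhoff P_drop bal r0 y2 q_bounded).
have rho_pos t a : 0 <= t -> a \in E :\: H -> 0 < rho t a.
  exact: (rho_gt0 sigma_pos).
have rho_pi t a : 0 <= t -> a \in pi ->
    rho t a = sigma 0 a * expR (drop (q t) a / len a).
  move=> t0 api; rewrite /rho (rhoE hlen sigma_pos P_drop r y t0 (piF a api)).
  by rewrite tight// subrr mul0r subr0.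
have q_pi : exists2 K, 0 <= K &
    forall t i, 0 <= t -> i \in x :: rcons s z -> `|q t i| <= K.
  have [C C0 hC] : exists2 C, 0 <= C & forall a t, a \in E :\: H -> 0 <= t ->
      `|len a * (rho t a / sigma 0 a)| <= C.
    apply: bounded_all => a aF; apply: bounded_mul; first exact: bounded_cst.
    by apply: bounded_mul; [exact: rho_bnd|exact: bounded_cst].
  have [Cx hCx] := q_bounded x xH; have [Cz hCz] := q_bounded z zH.
  have Cx0 : 0 <= Cx by apply: le_trans (hCx 0 (lexx _)).
  have Cz0 : 0 <= Cz by apply: le_trans (hCz 0 (lexx _)).
  have n0 : 0 <= (size (rcons s z))%:R * C by rewrite mulr_ge0.
  exists (Cx + Cz + (size (rcons s z))%:R * C); first by rewrite !addr_ge0.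
  move=> t i t0 iw.
  (* By [x <= e^x] at [x = drop q / len], where [e^x = rho / sigma 0]. *)
  have hd a : a \in pi -> drop (q t) a <= C.
    move=> api; have aF := piF a api; have /setDP[aE _] := aF; have la := hlen aE.
    apply: le_trans (hC a t aF t0); apply: le_trans (ler_norm _).
    rewrite rho_pi// mulrAC mulfV ?mul1r ?gt_eqF ?sigma0//.
    rewrite -ler_pdivrMl// mulrC; apply: le_trans (expR_ge1Dx _).
    by rewrite lerDr.
  have := path_drop_bound C0 hd iw; rewrite last_rcons => /andP[h1 h2].
  have := hCx t t0; have := hCz t t0; rewrite !ler_norml => /andP[? ?] /andP[? ?].
  by apply/andP; split; lra.
have verts_new i : i \in verts (H :|: [set a in pi]) ->
    i \in verts H \/ i \in x :: rcons s z.
  case/vertsP => a + hi; rewrite finset.in_setU => /orP[aH|].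
    by left; apply/vertsP; exists a.
  rewrite inE => api; have /andP[h1 h2] := mem_path_arcs api.
  by right; case: hi => ->; [exact: mem_belast|rewrite inE h2 orbT].
have u_pi i : i \in x :: rcons s z -> exp_decay (fun t => p t i - y i).
  have hF : loopless (E :\: H) by move=> j; apply: contra (hE j) => /setDP[].
  have u_bnd j : bounded_on_ray (fun t => p t j - y j).
    by apply: bounded_sub; [exact: p_bounded|exact: bounded_cst].
  have en a : a \in E :\: H ->
      exp_decay (fun t => rho t a * drop (fun i => p t i - y i) a ^+ 2).
    apply: (energy_decay (r := r) (len := len) hF)
        => [c /setDP[/hlen]//|t c t0 cF|j|j|c cF].
    - by rewrite ltW ?rho_pos.
    - exact: p_bounded.
    (* On [H] the factor [p - y] decays by the invariant and the divergences are bounded; off [H]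
       the roles are exchanged. *)
    - case: (boolP (j \in verts H)) => jH.
        apply: exp_decay_mul; first by rewrite y1//; exact: hp.
        apply: bounded_sub; last first.
          by apply: bounded_mul; [exact: bounded_cst|exact: bounded_divergence].
        apply: bounded_divergence => c cF.
        apply: bounded_mul; last exact: bounded_cst.
        by apply: bounded_mul; [exact: rho_bnd|apply: bounded_sub; exact: p_bounded].
      have := exp_decay_mul (exp_decay_exp (- (r * imbalance E b sigma j)) r0) (u_bnd j).
      move/exp_decay_le; apply=> t t0.
      have d1 : divergence (E :\: H) (fun c => rho t c * drop (p t) c / len c) j = 0.
        exact: (divergence_rho_current kirchhoff bal r t0 jH).
      have d2 : divergence (E :\: H) (rho t) j = imbalance E b sigma j * expR (- r * t).
        exact: (divergence_rho sigma_der kirchhoff bal r t0 jH).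
      rewrite d1 d2.
      rewrite (_ : - (r * imbalance E b sigma j) * _ * _ = (p t j - y j) *
        (0 - r * (imbalance E b sigma j * expR (- r * t))))//.
      by ring.
    exact: (slack_rho_decay hE hlen sigma_der sigma_pos kirchhoff P_drop bal r0 y2
      q_bounded).
  apply: (path_exp_decay (u := fun t i => p t i - y i)).
    by rewrite /= y1//; exact: hp.
  have [K K0 hK] := q_pi; move=> a api; have aF := piF a api.
  have /setDP[aE _] := aF; have la := hlen aE.
  (* A lower bound for [rho], since [|q| <= K] at both ends of the arc. *)
  apply: (drop_decay (c := sigma 0 a * expR (- (2 * K) / len a)) (en a aF)).
    by rewrite mulr_gt0 ?expR_gt0 ?sigma0.
  move=> t t0; rewrite rho_pi// ler_pM2l ?sigma0// ler_expR ler_pM2r ?invr_gt0//.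
  have /andP[/mem_belast h1 h2] := mem_path_arcs api.
  have := hK t a.1 t0 h1; have := hK t a.2 t0 _; rewrite inE h2 orbT /drop => /(_ isT).
  by rewrite !ler_norml => /andP[? ?] /andP[? ?]; lra.
split=> [i /HhatH|i /verts_new[iH|iw]|i /verts_new[iH|iw]].
- by case/vertsP => a aH hi; apply/vertsP; exists a; rewrite // inE aH.
- by rewrite p'H//; exact: hP.
- rewrite p'y//; have [K K0 hK] := q_pi; exists K => t t0; exact: hK.
- by rewrite p'H//; exact: hp.
- by rewrite p'y//; exact: u_pi.
Qed.

Lemma converges_on_extension (leV : rel V) H p0 Hs ps :
  harmonic_extension E len leV H p0 Hs ps -> converges_on H p0 -> converges_on Hs ps.
Proof.
elim=> // {}H {}p0 x s z p' {}Hs {}ps hsel p'H p'pi _ IH hc; apply: IH.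
exact: converges_on_step hc hsel p'H p'pi.
Qed.
End Convergence.

Theorem theorem2 (R : realType) (V : finType) (E : {set V * V})
    (len : V * V -> R) (b : V -> R) (leV : rel V)
    (sigma : R -> V * V -> R) (p : R -> V -> R)
    (phat : V -> R) (Hs : {set V * V}) (ps : V -> R)
    (hG : connected_digraph E)
    (hlen : forall a, a \in E -> 0 < len a)
    (hb : \sum_i b i = 0)
    (hfeasible : exists f, positive_flow E b f)
    (hconn : connected_on (verts (optimal_set E len b)) (optimal_set E len b))
    (hleV : total_order leV)
    (hsol : physarum_solution E len b sigma p)
    (hphat : optimal_potential (optimal_set E len b) len phat)
    (hext : harmonic_extension E len leV (optimal_set E len b) phat Hs ps) :
  exists a T : R, [/\ 0 < a, 0 <= T &
    forall t, T <= t ->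
      \big[Num.max/0]_(i in verts Hs) `|p t i - ps i| <= expR (- a * t)].
Proof.
have hE : loopless E by case: hG.
have [_ [_ [root root_in phat_root]]] := hphat.
have H0 : optimal_set E len b != finset.set0.
  by case/vertsP: root_in => a aH _; apply/set0Pn; exists a.
have [f f_opt f_supp] := full_optimal_flow H0.
have [sigma0 hpot hder] := hsol.
have [d hd] : exists d : V * V -> R, forall a, a \in E ->
    has_derivative_in `[0, +oo[%classic (sigma^~ a) 0 (d a) /\
    d a + sigma 0 a = current len (sigma 0) (p 0) a.
  pose D a e := a \in E -> has_derivative_in `[0, +oo[%classic (sigma^~ a) 0 e /\
    e + sigma 0 a = current len (sigma 0) (p 0) a.
  suff /choice[d hd] : forall a, exists e, D a e by exists d.
  move=> a; rewrite /D; case: (boolP (a \in E)) => aE; last by exists 0.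
  by have [e h1 h2] := hder 0 a (lexx _) aE; exists e.
(* [sg] agrees with [sigma] for [t >= 0] and has a two-sided derivative at [0]. *)
pose sg t a := extend_left (sigma^~ a) (d a) t.
have sgE (t : R) : 0 <= t -> sg t = sigma t.
  by move=> t0; apply: funext => a; rewrite /sg /extend_left ltNge t0.
have sg_der (t : R) a : 0 <= t -> a \in E ->
    is_derive t (1 : R) (sg^~ a) (sg t a * (drop (p t) a / len a - 1)).
  move=> t0 aE; rewrite sgE//; have [e he e_eq] := hder t a t0 aE.
  have [d1 d2] := hd a aE.
  have -> : sigma t a * (drop (p t) a / len a - 1) = e.
    rewrite -[e](addrK (sigma t a)) e_eq /current /drop; ring.
  apply: extend_left_is_derive => // t_0; move: e_eq; rewrite t_0 -d2.
  exact: addIr.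
have kir (t : R) i : 0 <= t -> divergence E (current len (sg t) (p t)) i = b i.
  by move=> t0; rewrite sgE// -sum_laplacian//; have [] := hpot t t0.
have pmin (t : R) : 0 <= t -> min_zero_on [set: V] (p t) by move=> /hpot[].
have sg0 a : a \in E -> 0 < sg 0 a by rewrite sgE//; exact: sigma0.
have sg_pos := sigma_pos hG hlen f_opt f_supp hconn hphat root_in sg0 sg_der kir pmin.
have [P hP] := integrated_potential root hG sg_der hlen sg_pos.
have base := converges_on_optimal hG hlen f_opt f_supp hconn hphat root_in phat_root
  sg0 sg_der kir pmin hP.
have [_ _ dec] := converges_on_extension hG hlen f_opt f_supp hconn hphat root_in
  sg0 sg_der kir pmin hP hext base.
have [a [T [a0 T0 h]]] := exp_decay_all dec.
(* The default value [0] of the maximum must also lie below the exponential. *)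
exists a, T; split=> // t tT; apply: bigmax_le; first exact: expR_ge0.
by move=> i iH; apply: h.
Qed.
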